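(* Let $(M,g_{ab})$ be a vacuum spacetime (vanishing Ricci tensor) of Petrov type D, let $o^A,\iota^A$ be the two repeated principal spinors of the Weyl spinor $\Psi_{ABCD}$, normalized so that $o_A\iota^A=1$, and let $\Psi_2=\Psi_{ABCD}o^Ao^B\iota^C\iota^D$. (a) If $f=\Psi_2^{1/3}$, then each of the spinors $$L_{ABCA'}=-f^{-1}o_{(A}\nabla_{B|A'|}\iota_{C)},\qquad L_{ABCA'}=f^{-1}\iota_{(A}\nabla_{B|A'|}o_{C)}$$ satisfies $$\Psi_{ABCD}=2f\,\nabla_{(A}{}^{A'}L_{BCD)A'}.$$ (b) If $f=\Psi_2^{2/3}$, then each of the spinors $$L_{ABCA'}=3f^{-1}\Bigl(\iota_{(A}\nabla_{B|A'|}o_{C)}-\iota^{D}o_{(A}\iota_{B}\nabla_{C)A'}o_{D}\Bigr),$$ $$L_{ABCA'}=-3f^{-1}\Bigl(o_{(A}\nabla_{B|A'|}\iota_{C)}+o^{D}o_{(A}\iota_{B}\nabla_{C)A'}\iota_{D}\Bigr)$$ satisfies $$\Psi_{ABCD}=2f\,\nabla_{(A}{}^{A'}L_{BCD)A'}.$$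
   Context: Spacetime: a smooth four-dimensional Lorentzian manifold of signature $(+,-,-,-)$ with 2-spinor structure; conventions are those of Penrose and Rindler, ''Spinors and Space-Time'', Vol. 1. $\nabla_{AA'}$ is the Levi-Civita spinor derivative. Spinor indices are raised and lowered with the skew spinor $\varepsilon_{AB}$ by $\kappa_B=\kappa^A\varepsilon_{AB}$, $\kappa^A=\varepsilon^{AB}\kappa_B$ (similarly for primed indices). Round brackets denote symmetrization over the unprimed free indices $A,B,C,\dots$ enclosed, with indices between vertical bars excluded; the contracted index $D$ in (b) does not take part in the symmetrization. All fields are smooth. The Weyl spinor $\Psi_{ABCD}=\Psi_{(ABCD)}$ is determined by $\nabla_{A'(A}\nabla_{B}{}^{A'}\kappa_{C)}=-\Psi_{ABC}{}^{D}\kappa_D$ for all spinor fields $\kappa_A$. Petrov type D means that at every point $\Psi_{ABCD}$ is nonzero and proportional to $o_{(A}o_B\iota_C\iota_{D)}$ for two linearly independent spinors $o_A,\iota_A$ (the repeated principal spinors); with $o_A\iota^A=1$ one has $\Psi_{ABCD}=6\Psi_2\,o_{(A}o_B\iota_C\iota_{D)}$ with $\Psi_2\neq0$. The fractional powers of $\Psi_2$ are taken with respect to a smooth choice of branch $\Psi_2^{1/3}$ in the region considered, and $\Psi_2^{2/3}=(\Psi_2^{1/3})^2$. *)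

(* Defs.v *)
From HB Require Import structures.
From mathcomp Require Import all_boot all_order all_algebra.
From mathcomp Require Import all_classical all_reals all_analysis.
From mathcomp Require Export complex.

Set Implicit Arguments.
Unset Strict Implicit.
Unset Printing Implicit Defensive.

Import Order.TTheory GRing.Theory Num.Theory.
Import numFieldNormedType.Exports.

Local Open Scope classical_set_scope.
Local Open Scope ring_scope.
Local Open Scope complex_scope.

Section Smoothness.
Variable R : realType.

(* Only meaningful for open U: continuity and the partial derivatives at a
   point of U then depend on f near that point, hence on U, only. *)
Fixpoint C_k (k : nat) (U : set 'rV[R]_4) (f : 'rV[R]_4 -> R) : Prop :=
  (forall x, U x -> {for x, continuous f}) /\
  (if k is k'.+1 then
     forall j : 'I_4,
       (forall x, U x -> derivable f x (delta_mx 0 j)) /\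
       C_k k' U (fun x => 'D_(delta_mx 0 j) f x)
   else True).

Definition smooth_on (U : set 'rV[R]_4) (f : 'rV[R]_4 -> R) : Prop :=
  forall k, C_k k U f.

(* [param] is the inverse of [coord]; its values outside [coord @` dom] are
   irrelevant. *)
Record chart (T : topologicalType) := Chart {
  dom : set T;
  coord : T -> 'rV[R]_4;
  param : 'rV[R]_4 -> T;
  dom_open : open dom;
  codom_open : open (coord @` dom);
  coordK : forall p, dom p -> param (coord p) = p;
  coord_continuous : {within dom, continuous coord};
  param_continuous : {within coord @` dom, continuous param} }.

Record manifold4 := Manifold4 {
  points :> topologicalType;
  points_hausdorff : hausdorff_space points;
  points_second_countable : @second_countable points;
  atlas : set (chart points);
  atlas_cover : forall p : points, exists2 c, atlas c & dom c p;
  atlas_smooth : forall c d, atlas c -> atlas d -> forall j : 'I_4,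
    smooth_on (coord d @` (dom c `&` dom d))
              (fun x => coord c (param d x) 0 j) }.

End Smoothness.

Section Tensors.
Variables (R : realType) (M : manifold4 R).

Definition smooth (f : M -> R) : Prop :=
  forall c, atlas c -> smooth_on (coord c @` dom c) (f \o param c).

Definition csmooth (f : M -> R[i]) : Prop :=
  smooth (fun p => complex.Re (f p)) /\ smooth (fun p => complex.Im (f p)).

Definition tvec := (M -> R) -> R.

(* Tangent vectors at p are the derivations at p of the smooth functions. They
   are extended by 0 to the other functions, so that two tangent vectors
   are equal as soon as they agree on smooth functions. *)
Definition tangent (p : M) (v : tvec) : Prop :=
  [/\ forall f, ~ smooth f -> v f = 0,
      forall a f h, smooth f -> smooth h ->
        v (fun q => a * f q + h q) = a * v f + v h
    & forall f h, smooth f -> smooth h ->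
        v (fun q => f q * h q) = f p * v h + h p * v f].

Definition smooth_vfield (X : M -> tvec) : Prop :=
  (forall p, tangent p (X p)) /\
  (forall f, smooth f -> smooth (fun p => X p f)).

Definition tangent_basis (p : M) (b : 'I_4 -> tvec) : Prop :=
  (forall j, tangent p (b j)) /\
  (forall v, tangent p v ->
     exists! c : 'rV[R]_4, v = (fun f => \sum_j c 0 j * b j f)).

Definition minkowski (j k : 'I_4) : R :=
  if j == k then (if j == 0 then 1 else -1) else 0.

(* [g p] only matters on the tangent vectors at p. *)
Definition lorentzian_metric (g : M -> tvec -> tvec -> R) : Prop :=
  [/\ forall p u v, tangent p u -> tangent p v -> g p u v = g p v u,
      forall p a u v w, tangent p u -> tangent p v -> tangent p w ->
        g p (fun f => a * u f + v f) w = a * g p u w + g p v w,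
      forall p, exists2 b, tangent_basis p b &
        forall j k, g p (b j) (b k) = minkowski j k
    & forall X Y, smooth_vfield X -> smooth_vfield Y ->
        smooth (fun p => g p (X p) (Y p))].

Definition orthonormal_tetrad (g : M -> tvec -> tvec -> R)
    (E : 'I_4 -> M -> tvec) : Prop :=
  (forall j, smooth_vfield (E j)) /\
  (forall p j k, g p (E j p) (E k p) = minkowski j k).

End Tensors.

Section SpinorAlgebra.
Variable R : realType.
Local Notation C := R[i].

(* Both eps_{AB} and eps^{AB}, with eps_{01} = eps^{01} = 1; the same matrix
   serves for the primed indices. *)
Definition eps (A B : 'I_2) : C :=
  if A == B then 0 else if A == 0 then 1 else -1.

(* k^A = eps^{AB} k_B *)
Definition raise (k : 'I_2 -> C) (A : 'I_2) : C := \sum_B eps A B * k B.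

Definition sym3 (T : 'I_2 -> 'I_2 -> 'I_2 -> C) (A B D : 'I_2) : C :=
  (T A B D + T A D B + T B A D + T B D A + T D A B + T D B A) / 6.

Definition sym4 (T : 'I_2 -> 'I_2 -> 'I_2 -> 'I_2 -> C) (A B D F : 'I_2) : C :=
  (sym3 (T A) B D F + sym3 (T B) A D F + sym3 (T D) A B F + sym3 (T F) A B D)
  / 4.

Definition independent (o iota : 'I_2 -> C) : Prop :=
  forall a b : C, (forall A, a * o A + b * iota A = 0) -> a = 0 /\ b = 0.

Definition repeated_principal_spinors
    (P : 'I_2 -> 'I_2 -> 'I_2 -> 'I_2 -> C) (o iota : 'I_2 -> C) : Prop :=
  [/\ exists A B D F, P A B D F != 0,
      independent o iota
    & exists c : C, forall A B D F, P A B D F =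
        c * sym4 (fun A B D F => o A * o B * iota D * iota F) A B D F].

End SpinorAlgebra.

(* The spin bundle is M x C^2 with eps constant. This loses no generality in
   the presence of two global spinor fields with o_A iota^A = 1, since these
   form a global spin frame. Its identification with the tangent bundle is
   then an orthonormal tetrad E, through the Infeld-van der Waerden symbols.
   Spinor fields are given by their components with all indices down, in a
   reference spin frame that is independent of o and iota. *)
Section SpinorCalculus.
Variables (R : realType) (M : manifold4 R).
Local Notation C := R[i].
Variable E : 'I_4 -> M -> tvec M.

Definition cder (v : tvec M) (f : M -> C) : C :=
  v (fun q => complex.Re (f q)) +i* v (fun q => complex.Im (f q)).

(* The derivation along the complex vector e_{AA'}, where
   V^a = V^{AA'} e_{AA'} and V^{AA'} is the matrix
   2^{-1/2} (V^0 + V^3, V^1 + i V^2 ; V^1 - i V^2, V^0 - V^3);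
   in particular g(e_{AA'}, e_{BB'}) = eps_{AB} eps_{A'B'}. *)
Definition sigma (A A' : 'I_2) (f : M -> C) (p : M) : C :=
  let d j := cder (E j p) f in
  ((Num.sqrt 2)^-1)%:C *
  match val A, val A' with
  | 0%N, 0%N => d 0 + d 3
  | 0%N, _ => d 1 - 'i * d 2
  | _, 0%N => d 1 + 'i * d 2
  | _, _ => d 0 - d 3
  end.

(* Connection coefficients: nabla_{AA'} k_B = sigma_{AA'} k_B - G_{AA'B}^D k_D.
   Reality of nabla fixes those for the primed indices. *)
Variable G : 'I_2 -> 'I_2 -> 'I_2 -> 'I_2 -> M -> C.

Definition conn (A A' : 'I_2) (p : M) (k : 'I_2 -> C) (B : 'I_2) : C :=
  \sum_D G A A' B D p * k D.

Definition connb (A A' : 'I_2) (p : M) (k : 'I_2 -> C) (B' : 'I_2) : C :=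
  \sum_D (G A' A B' D p)^* * k D.

(* The two digits count the unprimed and the primed indices of the argument. *)
Definition nabla10 (k : 'I_2 -> M -> C) (A A' B : 'I_2) (p : M) : C :=
  sigma A A' (k B) p - conn A A' p (k^~ p) B.

Definition nabla20 (T : 'I_2 -> 'I_2 -> M -> C) (A A' B D : 'I_2) (p : M) : C :=
  sigma A A' (T B D) p
  - conn A A' p (fun X => T X D p) B
  - conn A A' p (fun X => T B X p) D.

Definition nabla11 (T : 'I_2 -> 'I_2 -> M -> C) (A A' B B' : 'I_2) (p : M) : C :=
  sigma A A' (T B B') p
  - conn A A' p (fun X => T X B' p) B
  - connb A A' p (fun X => T B X p) B'.

(* T_{BB'D} *)
Definition nabla21 (T : 'I_2 -> 'I_2 -> 'I_2 -> M -> C)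
    (A A' B B' D : 'I_2) (p : M) : C :=
  sigma A A' (T B B' D) p
  - conn A A' p (fun X => T X B' D p) B
  - connb A A' p (fun X => T B X D p) B'
  - conn A A' p (fun X => T B B' X p) D.

(* T_{BB'DD'} *)
Definition nabla22 (T : 'I_2 -> 'I_2 -> 'I_2 -> 'I_2 -> M -> C)
    (A A' B B' D D' : 'I_2) (p : M) : C :=
  sigma A A' (T B B' D D') p
  - conn A A' p (fun X => T X B' D D' p) B
  - connb A A' p (fun X => T B X D D' p) B'
  - conn A A' p (fun X => T B B' X D' p) D
  - connb A A' p (fun X => T B B' D X p) D'.

(* T_{BDFF'} *)
Definition nabla31 (T : 'I_2 -> 'I_2 -> 'I_2 -> 'I_2 -> M -> C)
    (A A' B D F F' : 'I_2) (p : M) : C :=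
  sigma A A' (T B D F F') p
  - conn A A' p (fun X => T X D F F' p) B
  - conn A A' p (fun X => T B X F F' p) D
  - conn A A' p (fun X => T B D X F' p) F
  - connb A A' p (fun X => T B D F X p) F'.

(* nabla eps = 0 makes the induced connection on tensors metric, because
   g_{ab} = eps_{AB} eps_{A'B'}. *)
Definition levi_civita_spinor_derivative : Prop :=
  [/\ forall A A' B D, csmooth (G A A' B D),
      forall A A' B D p, nabla20 (fun B D _ => eps R B D) A A' B D p = 0
    & forall f, csmooth f -> forall A A' B B' p,
        nabla11 (fun B B' => sigma B B' f) A A' B B' p =
        nabla11 (fun A A' => sigma A A' f) B B' A A' p].

(* (nabla_a nabla_b - nabla_b nabla_a) w_c = - R_{abc}^d w_d, equivalently
   (nabla_a nabla_b - nabla_b nabla_a) V^d = R_{abc}^d V^c, where a stands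
   for the pair AA'. *)
Definition is_riemann_tensor
    (Rm : 'I_2 * 'I_2 -> 'I_2 * 'I_2 -> 'I_2 * 'I_2 -> 'I_2 * 'I_2 -> M -> C) :
    Prop :=
  (forall a b c d, csmooth (Rm a b c d)) /\
  (forall w : 'I_2 -> 'I_2 -> M -> C, (forall B B', csmooth (w B B')) ->
     forall A A' B B' D D' p,
       nabla22 (nabla11 w) A A' B B' D D' p
       - nabla22 (nabla11 w) B B' A A' D D' p =
       - \sum_(d : 'I_2 * 'I_2) Rm (A, A') (B, B') (D, D') d p * w d.1 d.2 p).

(* R_{ab} = R_{acb}^c *)
Definition ricci
    (Rm : 'I_2 * 'I_2 -> 'I_2 * 'I_2 -> 'I_2 * 'I_2 -> 'I_2 * 'I_2 -> M -> C)
    (a b : 'I_2 * 'I_2) (p : M) : C :=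
  \sum_(c : 'I_2 * 'I_2) Rm a c b c p.

(* The last clause is
   nabla_{A'(A} nabla_B^{A'} k_{D)} = - Psi_{ABD}^F k_F. *)
Definition is_weyl_spinor (Psi : 'I_2 -> 'I_2 -> 'I_2 -> 'I_2 -> M -> C) :
    Prop :=
  [/\ forall A B D F, csmooth (Psi A B D F),
      forall A B D F p,
        Psi A B D F p = sym4 (fun A B D F => Psi A B D F p) A B D F
    & forall k : 'I_2 -> M -> C, (forall A, csmooth (k A)) ->
        forall A B D p,
          sym3 (fun A B D => \sum_A' \sum_B'
                  eps R A' B' * nabla21 (nabla10 k) A A' B B' D p) A B D =
          - \sum_F raise (fun X => Psi A B D X p) F * k F p].

Definition petrov_type_D (Psi : 'I_2 -> 'I_2 -> 'I_2 -> 'I_2 -> M -> C) : Prop :=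
  forall p, exists o iota,
    repeated_principal_spinors (fun A B D F => Psi A B D F p) o iota.

(* nabla_A^{A'} L_{BDFA'} *)
Definition curl (L : 'I_2 -> 'I_2 -> 'I_2 -> 'I_2 -> M -> C)
    (A B D F : 'I_2) (p : M) : C :=
  \sum_A' raise (fun X => nabla31 L A X B D F A' p) A'.

End SpinorCalculus.

(* Main.v *)
Require Import Defs.
From HB Require Import structures.
From mathcomp Require Import all_boot all_order all_algebra.
From mathcomp Require Import all_classical all_reals all_analysis.
From mathcomp Require Import ring.
Set Implicit Arguments.
Unset Strict Implicit.
Unset Printing Implicit Defensive.

Import Order.TTheory GRing.Theory Num.Theory.
Import numFieldNormedType.Exports.
Local Open Scope ring_scope.

(* In vacuum the curvature of the spin connection reduces to the Weyl spinor:
   the first Bianchi identity and Ric = 0 are linear equations in the components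
   of the spinor curvature that kill its Ricci spinor, its scalar part and its
   antisymmetric parts.  The Jacobi identity for covariant derivatives then gives
   nabla^{AA'} Psi_{ABCD} = 0.  For Psi_{ABCD} = 6 f^3 o_(A o_B iota_C iota_D)
   with f^3 = Psi_2, contracting this with o and iota shows that both principal
   spinors are geodesic and shear-free and expresses nabla f through the spin
   coefficients.  In the symmetrized curl of each L the second derivatives only
   enter through nabla_{A'(A} nabla_{B)}^{A'}, that is, through Psi, and the terms
   quadratic in the spin coefficients cancel. *)

(** Everything is checked in components, and the obstacle is that the frame vectors e_{AA'} do not
    commute. Smooth complex functions are therefore packed into a commutative ring on which the
    frame acts by derivations. Equality in that ring is equality of functions, so it may be
    differentiated again, and the curvature identities become polynomial computations. No Lie
    bracket is introduced: torsion-freeness expresses the structure functions of the frame by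
    connection coefficients. The Jacobi identity on functions constrains these structure functions
    because the e_{AA'} are linearly independent, which comes from the orthonormality of the tetrad.

    In both cases the computation is done with f the cube root of Psi_2, so the weight of (b) is
    f^2. At each point, once the derivatives of o, iota and f are expressed by the surviving spin
    coefficients, each claim is a polynomial identity in f, 1/f, the dyad and these coefficients,
    modulo f f^-1 = 1 and o_A iota^A = 1. *)

(** * Closure of C^k functions under the ring operations and inversion *)

Section SmoothFunctions.
Variables (R : realType).
Implicit Types (U : set 'rV[R]_4) (f g : 'rV[R]_4 -> R).

Lemma near_open U (P : 'rV[R]_4 -> Prop) x :
  open U -> (forall y, U y -> P y) -> U x -> \forall y \near x, P y.
Proof.
move=> oU UP Ux; apply: filterS UP _.
exact: open_nbhs_nbhs.
Qed.

(** The product and quotient rules give the partial derivatives at points of [U] only, so the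
    induction on [k] must be able to exchange functions that agree on [U]. Openness makes continuity
    and derivability at a point of [U] depend on these values alone. *)
Lemma C_k_ext k U f g : open U -> (forall x, U x -> f x = g x) ->
  C_k k U f -> C_k k U g.
Proof.
move=> oU.
have ext_cts h1 h2 : (forall x, U x -> h1 x = h2 x) ->
    (forall x, U x -> {for x, continuous h1}) ->
    forall x, U x -> {for x, continuous h2}.
  move=> h12 c1 x Ux; change (h2 y @[y --> x] --> h2 x)%classic.
  have nh : \forall y \near x, h1 y = h2 y.
    by apply: (near_open oU _ Ux) => y Uy; exact: h12.
  rewrite -h12 //; apply: cvg_trans (c1 _ Ux).
  exact: (near_eq_cvg nh).
elim: k f g => [|k IH] f g fg [cf df].
  by split => //; exact: ext_cts cf.
split; first exact: ext_cts cf.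
move=> j; have [dfj Cfj] := df j; split=> [x Ux|].
  have nfg := near_open (P := fun y => f y = g y) oU (fg) Ux.
  exact: (near_eq_derivable nfg (dfj _ Ux)).
apply: IH Cfj => x Ux.
have nfg := near_open (P := fun y => f y = g y) oU (fg) Ux.
exact: near_eq_derive nfg.
Qed.

Lemma C_kW k U f : C_k k.+1 U f -> C_k k U f.
Proof.
elim: k f => [|k IH] f [cf df]; split => // j.
by have [dj Cj] := df j; split => //; exact: IH.
Qed.

Lemma C_k_cst k U (a : R) : C_k k U (fun=> a).
Proof.
elim: k a => [|k IH] a;
  (split; first by move=> x _; exact: (@cst_continuous _ _ a)) => //.
move=> j; split=> [x _|]; first exact: derivable_cst.
by under eq_fun do rewrite derive_cst; exact: IH.
Qed.

Lemma C_kD k U f g : open U -> C_k k U f -> C_k k U g ->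
  C_k k U (fun x => f x + g x).
Proof.
move=> oU; elim: k f g => [|k IH] f g [cf df] [cg dg];
  (split; first by move=> x Ux; apply: continuousD; [exact: cf|exact: cg]) => //.
move=> j; have [dfj Cf] := df j; have [dgj Cg] := dg j; split=> [x Ux|].
  by apply: derivableD; [exact: dfj|exact: dgj].
apply: (C_k_ext oU _ (IH _ _ Cf Cg)) => x Ux.
by rewrite -deriveD; [|exact: dfj|exact: dgj].
Qed.

Lemma C_kM k U f g : open U -> C_k k U f -> C_k k U g ->
  C_k k U (fun x => f x * g x).
Proof.
move=> oU; elim: k f g => [|k IH] f g Cf Cg.
  split => // x Ux.
  by apply: continuousM; [exact: (proj1 Cf)|exact: (proj1 Cg)].
have [cf df] := Cf; have [cg dg] := Cg; split.
  by move=> x Ux; apply: continuousM; [exact: cf|exact: cg].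
move=> j; have [dfj Cfj] := df j; have [dgj Cgj] := dg j; split=> [x Ux|].
  by apply: derivableM; [exact: dfj|exact: dgj].
apply: (C_k_ext (f := fun x => f x * 'D_(delta_mx 0 j) g x
                     + g x * 'D_(delta_mx 0 j) f x)) => //.
  by move=> x Ux; rewrite deriveM; [|exact: dfj|exact: dgj].
by apply: C_kD => //; apply: IH => //; exact: C_kW.
Qed.

Lemma C_kV k U f : open U -> (forall x, U x -> f x != 0) -> C_k k U f ->
  C_k k U (fun x => (f x)^-1).
Proof.
move=> oU f0; elim: k => [|k IH] Cf.
  split => // x Ux.
  by apply: continuousV; [exact: f0|exact: (proj1 Cf)].
have [cf df] := Cf; split.
  by move=> x Ux; apply: continuousV; [exact: f0|exact: cf].
move=> j; have [dfj Cfj] := df j; split=> [x Ux|].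
  exact: (derivableV (f0 _ Ux) (dfj _ Ux)).
have CV := IH (C_kW Cf).
apply: (C_k_ext (f := fun x => (-1 * ((f x)^-1 * (f x)^-1))
                     * 'D_(delta_mx 0 j) f x)) => //.
  move=> x Ux; rewrite deriveV; [|exact: f0|exact: dfj].
  by rewrite mulN1r /GRing.scale /= -exprVn expr2.
apply: (C_kM oU) => //; apply: (C_kM oU); first exact: C_k_cst.
exact: C_kM.
Qed.

End SmoothFunctions.

(** * Smooth complex fields and their derivatives along the frame *)

Section SmoothFields.
Variables (R : realType) (M : manifold4 R).
Local Notation C := (complex R).
Local Open Scope complex_scope.

Lemma smooth_cst (a : R) : smooth (fun _ : M => a).
Proof. by move=> c _ k; exact: C_k_cst. Qed.

Lemma smoothD (f g : M -> R) :
  smooth f -> smooth g -> smooth (fun p => f p + g p).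
Proof.
move=> sf sg c ac k.
by apply: C_kD; [exact: codom_open|exact: sf|exact: sg].
Qed.

Lemma smoothM (f g : M -> R) :
  smooth f -> smooth g -> smooth (fun p => f p * g p).
Proof.
move=> sf sg c ac k.
by apply: C_kM; [exact: codom_open|exact: sf|exact: sg].
Qed.

Lemma smoothN (f : M -> R) : smooth f -> smooth (fun p => - f p).
Proof.
move=> sf; have := smoothM (smooth_cst (-1)) sf.
by under eq_fun do rewrite mulN1r.
Qed.

Lemma smoothV (f : M -> R) :
  (forall p, f p != 0) -> smooth f -> smooth (fun p => (f p)^-1).
Proof.
move=> f0 sf c ac k.
apply: (@C_kV _ _ _ (f \o param c)); [exact: codom_open|by move=> x _; exact: f0|].
exact: sf.
Qed.

Lemma csmooth_cst (a : C) : csmooth (fun _ : M => a).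
Proof. by split; exact: smooth_cst. Qed.

Lemma csmoothD (f g : M -> C) :
  csmooth f -> csmooth g -> csmooth (fun p => f p + g p).
Proof.
move=> [rf jf] [rg jg]; split.
  have := smoothD rf rg; congr smooth; apply/funext => p.
  by case: (f p) (g p) => [? ?] [].
have := smoothD jf jg; congr smooth; apply/funext => p.
by case: (f p) (g p) => [? ?] [].
Qed.

Lemma csmoothM (f g : M -> C) :
  csmooth f -> csmooth g -> csmooth (fun p => f p * g p).
Proof.
move=> [rf jf] [rg jg]; split.
  have := smoothD (smoothM rf rg) (smoothN (smoothM jf jg)).
  congr smooth; apply/funext => p.
  by case: (f p) (g p) => [? ?] [].
have := smoothD (smoothM rf jg) (smoothM jf rg).
congr smooth; apply/funext => p.
by case: (f p) (g p) => [? ?] [].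
Qed.

Lemma csmoothN (f : M -> C) : csmooth f -> csmooth (fun p => - f p).
Proof.
move=> sf; have := csmoothM (csmooth_cst (-1)) sf.
by under eq_fun do rewrite mulN1r.
Qed.

Lemma csmoothJ (f : M -> C) : csmooth f -> csmooth (fun p => (f p)^*%C).
Proof.
move=> [rf jf]; split.
  by move: rf; congr smooth; apply/funext => p; case: (f p).
by have := smoothN jf; congr smooth; apply/funext => p; case: (f p).
Qed.

(** Since 1/f = (Re f - i Im f) / |f|^2, only the real function |f|^2 has to be inverted. *)
Lemma csmoothV (f : M -> C) :
  (forall p, f p != 0) -> csmooth f -> csmooth (fun p => (f p)^-1).
Proof.
move=> f0 [rf jf].
have n0 p : complex.Re (f p) * complex.Re (f p)
   + complex.Im (f p) * complex.Im (f p) != 0.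
  have := f0 p; case: (f p) => x y /=; apply: contraNN => /eqP xy.
  have [x2 y2] : 0 <= x * x /\ 0 <= y * y.
    by rewrite -!expr2 !sqr_ge0.
  by rewrite eq_complex /= -[x == 0]orbb -[y == 0]orbb -!mulf_eq0;
    rewrite -(paddr_eq0 x2 y2) xy eqxx.
have sn := smoothV n0 (smoothD (smoothM rf rf) (smoothM jf jf)).
split.
  have := smoothM rf sn; congr smooth; apply/funext => p.
  by case: (f p) => x y /=; rewrite -!expr2.
have := smoothN (smoothM jf sn); congr smooth; apply/funext => p.
by case: (f p) => x y /=; rewrite -!expr2.
Qed.

Lemma csmooth_sum (I : finType) (F : I -> M -> C) :
  (forall i, csmooth (F i)) -> csmooth (fun p => \sum_i F i p).
Proof.
move=> sF; rewrite /index_enum; elim: (Finite.enum I) => [|i s IH].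
  by under eq_fun do rewrite big_nil; exact: csmooth_cst.
by under eq_fun do rewrite big_cons; exact: csmoothD.
Qed.

Section Tangent.
Variables (p : M) (v : tvec M).
Hypothesis tv : tangent p v.

Lemma tangentD f h : smooth f -> smooth h ->
  v (fun q => f q + h q) = v f + v h.
Proof.
case: tv => _ lin _ sf sh; have := lin 1 f h sf sh.
by under eq_fun do rewrite mul1r; rewrite mul1r.
Qed.

Lemma tangent_cst (a : R) : v (fun=> a) = 0.
Proof.
case: tv => _ lin lei.
have v0 : v (fun=> 0) = 0.
  have := tangentD (smooth_cst 0) (smooth_cst 0).
  under eq_fun do rewrite addr0.
  by move/eqP; rewrite -subr_eq0 opprD addNKr oppr_eq0 => /eqP.
have v1 : v (fun=> 1) = 0.
  have := lei _ _ (smooth_cst 1) (smooth_cst 1).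
  under eq_fun do rewrite mul1r.
  by rewrite mul1r => /eqP; rewrite -subr_eq0 opprD addNKr oppr_eq0 => /eqP.
have := lin a _ _ (smooth_cst 1) (smooth_cst 0).
under eq_fun do rewrite mulr1 addr0.
by rewrite v1 v0 mulr0 addr0.
Qed.

Lemma tangentN f : smooth f -> v (fun q => - f q) = - v f.
Proof.
move=> sf; case: tv => _ _ lei; have := lei _ _ (smooth_cst (-1)) sf.
under eq_fun do rewrite mulN1r.
by rewrite tangent_cst mulr0 addr0 mulN1r.
Qed.

Lemma tangentM f h : smooth f -> smooth h ->
  v (fun q => f q * h q) = f p * v h + h p * v f.
Proof. by case: tv => _ _; exact. Qed.

Lemma cder_cst (a : C) : cder v (fun=> a) = 0.
Proof. by rewrite /cder !tangent_cst. Qed.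

Lemma cderD f h : csmooth f -> csmooth h ->
  cder v (fun q => f q + h q) = cder v f + cder v h.
Proof.
move=> [rf jf] [rh jh]; rewrite /cder.
have -> : (fun q => complex.Re (f q + h q)) =
  (fun q => complex.Re (f q) + complex.Re (h q)).
  by apply/funext => q; case: (f q) (h q) => [? ?] [].
have -> : (fun q => complex.Im (f q + h q)) =
  (fun q => complex.Im (f q) + complex.Im (h q)).
  by apply/funext => q; case: (f q) (h q) => [? ?] [].
by rewrite !tangentD.
Qed.

Lemma cderM f h : csmooth f -> csmooth h ->
  cder v (fun q => f q * h q) = f p * cder v h + h p * cder v f.
Proof.
move=> [rf jf] [rh jh]; rewrite /cder.
have -> : (fun q => complex.Re (f q * h q)) =
  (fun q => complex.Re (f q) * complex.Re (h q)
            + - (complex.Im (f q) * complex.Im (h q))).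
  by apply/funext => q; case: (f q) (h q) => [? ?] [].
have -> : (fun q => complex.Im (f q * h q)) =
  (fun q => complex.Re (f q) * complex.Im (h q)
            + complex.Im (f q) * complex.Re (h q)).
  by apply/funext => q; case: (f q) (h q) => [? ?] [].
rewrite !tangentD ?tangentN ?tangentM //; do ?[exact: smoothM|apply: smoothN].
case: (f p) (h p) => [x y] [z t] /=.
by apply/eqP; rewrite eq_complex /=; apply/andP; split; apply/eqP; ring.
Qed.

End Tangent.

Variable E : 'I_4 -> M -> tvec M.
Hypothesis vE : forall j, smooth_vfield (E j).

Lemma csmooth_cder j f : csmooth f -> csmooth (fun p => cder (E j p) f).
Proof. by case: (vE j) => _ sE [rf jf]; split; exact: sE. Qed.

Lemma csmooth_sigma A A' f : csmooth f -> csmooth (sigma E A A' f).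
Proof.
move=> sf; have sE j := csmooth_cder j sf; apply: csmoothM.
  exact: csmooth_cst.
by case: A A' => [[|?] ?] [[|?] ?] /=;
  do ?[apply: csmoothD|apply: csmoothN|apply: csmoothM|exact: csmooth_cst|exact: sE].
Qed.

Lemma sigma_cst A A' (a : C) p : sigma E A A' (fun=> a) p = 0.
Proof.
have tE j := (vE j).1 p.
rewrite /sigma !(cder_cst (tE _)).
by case: A A' => [[|?] ?] [[|?] ?] /=; rewrite ?mulr0 ?addr0 ?subr0 mulr0.
Qed.

Lemma sigmaD A A' f h p : csmooth f -> csmooth h ->
  sigma E A A' (fun q => f q + h q) p = sigma E A A' f p + sigma E A A' h p.
Proof.
move=> sf sh; have tE j := (vE j).1 p.
rewrite /sigma !(cderD (tE _)) //.
by case: A A' => [[|?] ?] [[|?] ?] /=; ring.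
Qed.

Lemma sigmaM A A' f h p : csmooth f -> csmooth h ->
  sigma E A A' (fun q => f q * h q) p =
  sigma E A A' f p * h p + f p * sigma E A A' h p.
Proof.
move=> sf sh; have tE j := (vE j).1 p.
rewrite /sigma !(cderM (tE _)) //.
by case: A A' => [[|?] ?] [[|?] ?] /=; ring.
Qed.

End SmoothFields.

(** * Linear independence of the real tetrad and of the vectors e_{AA'} *)

Section TetradIndependence.
Variables (R : realType) (M : manifold4 R).
Local Notation C := (complex R).
Local Open Scope complex_scope.

Lemma tangent0 (p : M) : tangent p (fun=> 0).
Proof. by split=> *; rewrite ?mulr0 ?addr0. Qed.

Lemma tangent_comb (p : M) (a : R) (u v : tvec M) :
  tangent p u -> tangent p v -> tangent p (fun f => a * u f + v f).
Proof.
move=> [u0 ul um] [v0 vl vm]; split=> [f nf|b f h sf sh|f h sf sh].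
- by rewrite u0 // v0 // mulr0 addr0.
- by rewrite ul // vl //; ring.
- by rewrite um // vm //; ring.
Qed.

Variables (g : M -> tvec M -> tvec M -> R) (hg : lorentzian_metric g).
Variables (E : 'I_4 -> M -> tvec M) (hE : orthonormal_tetrad g E).

(** Pairing the vanishing combination with [E k] leaves plus or minus [m k]. The nested sum ending
    in 0 is the shape produced by repeated use of [tangent_comb], to which linearity of the metric
    applies term by term. *)
Lemma tetrad_independent (p : M) (m : 'I_4 -> R) :
  (forall f, smooth f -> m 0 * E 0 p f + (m 1 * E 1 p f
     + (m 2 * E 2 p f + (m 3 * E 3 p f + 0))) = 0) ->
  forall j, m j = 0.
Proof.
move=> m0; have tE j := (hE.1 j).1 p.
have [_ glin _ _] := hg.
have g0 v : tangent p v -> g p (fun=> 0) v = 0.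
  move=> tv; have := glin p (-1) _ _ v (tangent0 p) (tangent0 p) tv.
  have -> : (fun f : M -> R => -1 * 0 + 0) = (fun=> 0) :> tvec M.
    by apply/funext => f; rewrite mulr0 addr0.
  by rewrite mulN1r addNr.
have t3 := tangent_comb (m 3) (tE 3) (tangent0 p).
have t2 := tangent_comb (m 2) (tE 2) t3.
have t1 := tangent_comb (m 1) (tE 1) t2.
have gm k : m 0 * Defs.minkowski R 0 k + (m 1 * Defs.minkowski R 1 k
     + (m 2 * Defs.minkowski R 2 k + (m 3 * Defs.minkowski R 3 k + 0))) = 0.
  rewrite -!(hE.2 p) -[RHS](g0 (E k p) (tE k)).
  have <- : (fun f => m 0 * E 0 p f + (m 1 * E 1 p f + (m 2 * E 2 p f
      + (m 3 * E 3 p f + 0)))) = (fun=> 0) :> tvec M; last first.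
    have t0 := tangent0 p.
    by rewrite (glin p (m 0)) // (glin p (m 1)) // (glin p (m 2)) //
      (glin p (m 3)) // g0.
  (* Tangent vectors are 0 on non-smooth functions by convention, so the combination is the zero
     vector and not merely zero on smooth functions. *)
  apply/funext => f; have [sf|nf] := pselect (smooth f); first exact: m0.
  by have E0 j : E j p f = 0; [case: (tE j) => + _ _; exact|
    rewrite !E0 !mulr0 !addr0].
have vE (j k : 'I_4) : (j == k) = (val j == val k) by [].
move=> j; have {gm m0} := gm j; rewrite /Defs.minkowski !vE.
have [n0 n1 n2 n3] : [/\ val (0 : 'I_4) = 0%N, val (1 : 'I_4) = 1%N,
   val (2 : 'I_4) = 2%N & val (3 : 'I_4) = 3%N] by split; vm_compute.
rewrite n0 n1 n2 n3.
have [->|[->|[->|->]]] : j = 0 \/ j = 1 \/ j = 2 \/ j = 3.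
  case: j => -[|[|[|[|//]]]] lj; [left|right; left|right; right; left|
    right; right; right]; exact: val_inj.
all: rewrite ?n0 ?n1 ?n2 ?n3 /= ?mulr0 ?mulr1 ?mulrN1 ?addr0 ?add0r //.
all: by move/eqP; rewrite oppr_eq0 => /eqP.
Qed.

Lemma sigma_independent (p : M) (k : 'I_2 -> 'I_2 -> C) :
  (forall f, csmooth f -> k 0 0 * sigma E 0 0 f p + k 0 1 * sigma E 0 1 f p
     + (k 1 0 * sigma E 1 0 f p + k 1 1 * sigma E 1 1 f p) = 0) ->
  forall A A', k A A' = 0.
Proof.
move=> k0.
(* The coefficients of the real tetrad after expanding each e_{AA'}. Tested on real functions, their
   real and imaginary parts satisfy separate relations. *)
pose m (j : 'I_4) : C := match val j with
  0%N => k 0 0 + k 1 1 | 1%N => k 0 1 + k 1 0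
  | 2%N => 'i * (k 1 0 - k 0 1) | _ => k 0 0 - k 1 1 end.
have tE j := (hE.1 j).1 p.
have key f : smooth f -> m 0 * (E 0 p f)%:C + (m 1 * (E 1 p f)%:C
     + (m 2 * (E 2 p f)%:C + (m 3 * (E 3 p f)%:C + 0))) = 0.
  move=> sf; have csf : csmooth (fun q => (f q)%:C).
    by split => //; exact: smooth_cst.
  have cE j : cder (E j p) (fun q => (f q)%:C) = (E j p f)%:C.
    by rewrite /cder /= (tangent_cst (tE j)).
  have := k0 _ csf; rewrite /sigma /= !cE => kk.
  have r0 : ((Num.sqrt 2)^-1 : R)%:C != 0 :> C.
    by rewrite eq_complex /= eqxx andbT invr_eq0 sqrtr_eq0 -ltNge ltr0n.
  apply: (mulfI r0); rewrite mulr0 -[RHS]kk /m /=.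
  by ring.
have reE (z : C) (x : R) : complex.Re (z * x%:C) = complex.Re z * x.
  by case: z => a b /=; rewrite mulr0 subr0.
have imE (z : C) (x : R) : complex.Im (z * x%:C) = complex.Im z * x.
  by case: z => a b /=; rewrite mulr0 add0r.
have reD (z t : C) : complex.Re (z + t) = complex.Re z + complex.Re t.
  by case: z t => ? ? [].
have imD (z t : C) : complex.Im (z + t) = complex.Im z + complex.Im t.
  by case: z t => ? ? [].
have mr := tetrad_independent (p := p) (m := fun j => complex.Re (m j)).
have mi := tetrad_independent (p := p) (m := fun j => complex.Im (m j)).
have {mr mi} m0 j : m j = 0.
  apply/eqP; rewrite eq_complex; apply/andP; split; apply/eqP.
    apply: mr => f sf; have h := congr1 (@complex.Re R) (key f sf).
    by rewrite !reD !reE in h; exact: h.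
  apply: mi => f sf; have h := congr1 (@complex.Im R) (key f sf).
  by rewrite !imD !imE in h; exact: h.
have := (m0 0, m0 1, m0 2, m0 3); rewrite /m /= => -[[[a0 a1] a2] a3].
have two0 : 2 != 0 :> C by rewrite pnatr_eq0.
have a2' : k 1 0 - k 0 1 = 0.
  apply: (mulfI (x := 'i : C)); last by rewrite a2 mulr0.
  by rewrite eq_complex /= oner_eq0 andbF.
have kill (x y z : C) : y = 0 -> z = 0 -> 2 * x = y + z -> x = 0.
  by move=> -> -> h; apply: (mulfI two0); rewrite h addr0 mulr0.
have k00 : k 0 0 = 0 by apply: (kill _ _ _ a0 a3); ring.
have k10 : k 1 0 = 0 by apply: (kill _ _ _ a1 a2'); ring.
have k11 : k 1 1 = 0 by move: a0; rewrite k00 add0r.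
have k01 : k 0 1 = 0 by move: a1; rewrite k10 addr0.
have two (A : 'I_2) : A = 0 \/ A = 1.
  by case: A => -[|[|//]] lA; [left|right]; exact: val_inj.
by move=> A A'; case: (two A) => ->; case: (two A') => ->.
Qed.

End TetradIndependence.

(** * The commutative ring of smooth complex functions *)

Section SmoothFunctionRing.
Variables (R : realType) (M : manifold4 R).
Local Notation C := (complex R).

Record csfun := CSFun { csfun_val :> M -> C; csfunP : csmooth csfun_val }.

Lemma csfun_ext (f h : csfun) : (forall p, f p = h p) -> f = h.
Proof.
case: f h => f sf [h sh] /= /funext fh; rewrite fh in sf *.
by rewrite (Prop_irrelevance sf sh).
Qed.

HB.instance Definition _ := gen_eqMixin csfun.
HB.instance Definition _ := gen_choiceMixin csfun.

Definition csfun_cst (a : C) := CSFun (csmooth_cst M a).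
Definition csfun_add (f h : csfun) := CSFun (csmoothD (csfunP f) (csfunP h)).
Definition csfun_mul (f h : csfun) := CSFun (csmoothM (csfunP f) (csfunP h)).
Definition csfun_opp (f : csfun) := CSFun (csmoothN (csfunP f)).
Definition csfun_conj (f : csfun) := CSFun (csmoothJ (csfunP f)).

Fact csfun_addA : associative csfun_add.
Proof. by move=> f h k; apply: csfun_ext => p /=; exact: addrA. Qed.
Fact csfun_addC : commutative csfun_add.
Proof. by move=> f h; apply: csfun_ext => p /=; exact: addrC. Qed.
Fact csfun_add0 : left_id (csfun_cst 0) csfun_add.
Proof. by move=> f; apply: csfun_ext => p /=; exact: add0r. Qed.
Fact csfun_addN : left_inverse (csfun_cst 0) csfun_opp csfun_add.
Proof. by move=> f; apply: csfun_ext => p /=; exact: addNr. Qed.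
HB.instance Definition _ := GRing.isZmodule.Build csfun
  csfun_addA csfun_addC csfun_add0 csfun_addN.

Fact csfun_mulA : associative csfun_mul.
Proof. by move=> f h k; apply: csfun_ext => p /=; exact: mulrA. Qed.
Fact csfun_mulC : commutative csfun_mul.
Proof. by move=> f h; apply: csfun_ext => p /=; exact: mulrC. Qed.
Fact csfun_mul1 : left_id (csfun_cst 1) csfun_mul.
Proof. by move=> f; apply: csfun_ext => p /=; exact: mul1r. Qed.
Fact csfun_mulD : left_distributive csfun_mul csfun_add.
Proof. by move=> f h k; apply: csfun_ext => p /=; exact: mulrDl. Qed.
HB.instance Definition _ := GRing.Zmodule_isComPzRing.Build csfun
  csfun_mulA csfun_mulC csfun_mul1 csfun_mulD.

Lemma csfunE :
  (forall (f h : csfun) p, (f + h) p = f p + h p)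
  * (forall (f h : csfun) p, (f * h) p = f p * h p)
  * (forall (f : csfun) p, (- f) p = - f p).
Proof. by []. Qed.

End SmoothFunctionRing.

Lemma sum2 (V : nmodType) (F : 'I_2 -> V) : \sum_i F i = F 0 + F 1.
Proof.
by rewrite !big_ord_recl big_ord0 addr0; congr (F _ + F _); apply: val_inj.
Qed.

Lemma sum22 (V : nmodType) (F : 'I_2 * 'I_2 -> V) :
  \sum_i F i = F (0, 0) + F (0, 1) + (F (1, 0) + F (1, 1)).
Proof.
transitivity (\sum_i \sum_j F (i, j)); last by rewrite !sum2.
by rewrite pair_big; apply: eq_bigr => -[].
Qed.

(** * Curvature and Bianchi identity for non-commuting derivations of a ring *)

Section DifferentialRing.
Variable S : comPzRingType.
Local Notation I := ('I_2 * 'I_2)%type.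
Variable d : I -> S -> S.
Hypothesis dD : forall a f h, d a (f + h) = d a f + d a h.
Hypothesis dM : forall a f h, d a (f * h) = d a f * h + f * d a h.

Lemma der0 a : d a 0 = 0.
Proof. by apply: (addrI (d a 0)); rewrite -dD !addr0. Qed.

Lemma derN a f : d a (- f) = - d a f.
Proof. by apply: (addrI (d a f)); rewrite -dD !subrr der0. Qed.

Lemma der1 a : d a 1 = 0.
Proof. by apply: (addrI (d a 1)); rewrite -[in RHS](mulr1 1) dM !mulr1 mul1r addr0. Qed.

Let dE := (dD, derN, dM, der0, der1).

Variable c : I -> I -> I -> S.
Hypothesis commutator : forall a b f,
  d a (d b f) - d b (d a f) = \sum_e c a b e * d e f.
Hypothesis independence : forall k : I -> S,
  (forall f, \sum_e k e * d e f = 0) -> forall e, k e = 0.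

Lemma der_swap a b f : d a (d b f) = d b (d a f) + \sum_e c a b e * d e f.
Proof. by rewrite -commutator addrC subrK. Qed.

(** The Jacobi identity for [d a], [d b], [d s] on an arbitrary [f] reduces to a combination of
    first derivatives of [f]; by independence each coefficient vanishes. *)
Lemma jacobi_structure a b s e :
  (d a (c b s e) + \sum_h c b s h * c a h e) +
  (d b (c s a e) + \sum_h c s a h * c b h e) +
  (d s (c a b e) + \sum_h c a b h * c s h e) = 0.
Proof.
pose K e := (d a (c b s e) + \sum_h c b s h * c a h e) +
  (d b (c s a e) + \sum_h c s a h * c b h e) +
  (d s (c a b e) + \sum_h c a b h * c s h e).
apply: (independence (k := K)) => f {e}.
have J : d a (d b (d s f) - d s (d b f)) + d b (d s (d a f) - d a (d s f))
   + d s (d a (d b f) - d b (d a f)) =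
   (d b (d s (d a f)) - d s (d b (d a f))) +
   (d s (d a (d b f)) - d a (d s (d b f))) +
   (d a (d b (d s f)) - d b (d a (d s f))).
  by rewrite !dE; ring.
move: J; rewrite !commutator /K !sum22 !dE.
have sw x y : d x (d y f) = d y (d x f) + \sum_e c x y e * d e f.
  exact: der_swap.
(* Reordering [d a (d e f)] into [d e (d a f)] makes the second derivatives cancel against the
   commutators acting on [d a f]. *)
rewrite ![d a (d (_, _) f)]sw ![d b (d (_, _) f)]sw ![d s (d (_, _) f)]sw !sum22.
move/eqP; rewrite -subr_eq0 => /eqP J; rewrite -[RHS]J.
by ring.
Qed.

Variable G : I -> 'I_2 -> 'I_2 -> S.

(** The direction [a] is a mere label and carries no connection term; this is why structure
    functions appear in the commutators below. *)
Definition cov a (v : 'I_2 -> S) C := d a (v C) - \sum_D G a C D * v D.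

Definition curvature a b C D :=
  d b (G a C D) - d a (G b C D)
  + \sum_X (G a C X * G b X D - G b C X * G a X D)
  + \sum_e c a b e * G e C D.

Lemma cov_commutator a b v C :
  cov a (cov b v) C - cov b (cov a v) C =
  \sum_D curvature a b C D * v D + \sum_e c a b e * cov e v C.
Proof.
rewrite /cov /curvature !sum2 !sum22 !sum2 !dE (der_swap a b (v C)) !sum22.
by ring.
Qed.

Lemma curvature_antisym a b C D :
  (forall e, c b a e = - c a b e) -> curvature b a C D = - curvature a b C D.
Proof. by move=> cN; rewrite /curvature !sum2 !sum22 !cN; ring. Qed.

Lemma curvature_trace0 a b : (forall e, G e 1 1 = - G e 0 0) ->
  curvature a b 1 1 = - curvature a b 0 0.
Proof.
move=> G0; rewrite /curvature !sum2 !sum22 !G0 !dE; ring.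
Qed.

Lemma dcov a u C : d a (u C) = cov a u C + \sum_D G a C D * u D.
Proof. by rewrite subrK. Qed.

Lemma covB e u w C : cov e (fun X => u X - w X) C = cov e u C - cov e w C.
Proof. by rewrite /cov !sum2 !dE; ring. Qed.

(** The connection acts on the spinor indices only. In the cyclic sum the term in [c] makes up for
    its absence on the labels [b] and [s]. *)
Definition dcurvature a b s C E :=
  d a (curvature b s C E)
  + \sum_X (curvature b s C X * G a X E - G a C X * curvature b s X E)
  + \sum_e c b s e * curvature a e C E.

(** Commutes [cov a] with the commutator of [cov b] and [cov s]. The coefficient of [cov h v] is one
    cyclic term of [jacobi_structure]. *)
Lemma cov_box a b s v C :
  cov a (fun X => \sum_D curvature b s X D * v D + \sum_e c b s e * cov e v X) C
  - (\sum_D curvature b s C D * cov a v D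
     + \sum_e c b s e * cov e (cov a v) C) =
  \sum_E dcurvature a b s C E * v E
  + \sum_h (d a (c b s h) + \sum_e c b s e * c a e h) * cov h v C.
Proof.
have zE e : cov a (cov e v) C = cov e (cov a v) C
    + (\sum_D curvature a e C D * v D + \sum_h c a e h * cov h v C).
  by rewrite -cov_commutator addrC subrK.
have dz e := dcov a (cov e v) C.
have dv := dcov a v.
rewrite /dcurvature {1}/cov; move: zE dz dv.
(* Generalizing keeps [dE] from rewriting inside the unfoldable [curvature]
   and [cov]. *)
move: curvature cov => F cv zE dz dv.
by rewrite !sum22 !sum2 !dE !dz !dv !zE !sum22 !sum2; ring.
Qed.

(** This is the Jacobi identity for the operators [cov]; the terms in first derivatives of the
    spinor drop out by [jacobi_structure]. *)
Lemma second_bianchi a b s C E :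
  dcurvature a b s C E + dcurvature b s a C E + dcurvature s a b C E = 0.
Proof.
(* A spinor with constant components, which isolates the column [E] of the curvature. *)
pose v X : S := (X == E)%:R.
pose W b s (u : 'I_2 -> S) X :=
  \sum_D curvature b s X D * u D + \sum_e c b s e * cov e u X.
have WE b' s' u : W b' s' u =
    (fun X => cov b' (cov s' u) X - cov s' (cov b' u) X).
  by apply/funext => X; rewrite cov_commutator.
have J : (cov a (W b s v) C - W b s (cov a v) C)
    + (cov b (W s a v) C - W s a (cov b v) C)
    + (cov s (W a b v) C - W a b (cov s v) C) = 0.
  by rewrite !WE !covB; ring.
move: J; rewrite !cov_box.
have vE (f : 'I_2 -> S) : \sum_X f X * v X = f E.
  rewrite (bigD1 E) //= /v eqxx mulr1 big1 ?addr0 // => X /negPf ->.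
  by rewrite mulr0.
rewrite !vE => J.
have K : \sum_e ((d a (c b s e) + \sum_h c b s h * c a h e) +
  (d b (c s a e) + \sum_h c s a h * c b h e) +
  (d s (c a b e) + \sum_h c a b h * c s h e)) * cov e v C = 0.
  by rewrite big1 // => e _; rewrite jacobi_structure mul0r.
rewrite -[RHS]J -[LHS]addr0 -[X in _ + X = _]K !sum22; ring.
Qed.

End DifferentialRing.

Section CovectorCommutator.
Variable S : comPzRingType.
Local Notation I := ('I_2 * 'I_2)%type.
Variable d : I -> S -> S.
Hypothesis dD : forall a f h, d a (f + h) = d a f + d a h.
Hypothesis dM : forall a f h, d a (f * h) = d a f * h + f * d a h.
Variable c : I -> I -> I -> S.
Hypothesis commutator : forall a b f,
  d a (d b f) - d b (d a f) = \sum_e c a b e * d e f.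
Variables G H : I -> 'I_2 -> 'I_2 -> S.

Definition cov11 a (w : 'I_2 -> 'I_2 -> S) B B' :=
  d a (w B B') - \sum_X G a B X * w X B' - \sum_X H a B' X * w B X.

(** [G] and [H] act on different indices, so their cross terms cancel and the two curvatures add. *)
Lemma cov11_commutator a b w B B' :
  cov11 a (cov11 b w) B B' - cov11 b (cov11 a w) B B' =
  \sum_X curvature d c G a b B X * w X B'
  + \sum_X curvature d c H a b B' X * w B X
  + \sum_e c a b e * cov11 e w B B'.
Proof.
rewrite /cov11 /curvature !sum2 !sum22 !sum2.
rewrite !(dD, derN dD, dM) (der_swap commutator a b (w B B')) !sum22.
by ring.
Qed.

End CovectorCommutator.

Lemma epsE (R : realType) :
  (eps R 0 0 = 0) * (eps R 0 1 = 1) * (eps R 1 0 = -1) * (eps R 1 1 = 0).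
Proof. by []. Qed.

(** * Curvature of the spin connection and the first Bianchi identity *)

Section SpinorCurvature.
Variables (R : realType) (M : manifold4 R).
Local Notation C := (complex R).
Local Notation I := ('I_2 * 'I_2)%type.
Variables (g : M -> tvec M -> tvec M -> R) (hg : lorentzian_metric g).
Variables (E : 'I_4 -> M -> tvec M) (hE : orthonormal_tetrad g E).
Variables (G : 'I_2 -> 'I_2 -> 'I_2 -> 'I_2 -> M -> C).
Hypothesis hG : levi_civita_spinor_derivative E G.

Local Notation S := (csfun M).

Definition der (a : I) (f : S) : S :=
  CSFun (csmooth_sigma hE.1 a.1 a.2 (csfunP f)).

Lemma derD a f h : der a (f + h) = der a f + der a h.
Proof.
by apply: csfun_ext => p; rewrite csfunE /= (sigmaD hE.1) //; exact: csfunP.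
Qed.

Lemma derM a f h : der a (f * h) = der a f * h + f * der a h.
Proof.
by apply: csfun_ext => p; rewrite !csfunE /= (sigmaM hE.1) //; exact: csfunP.
Qed.

Definition Gam (a : I) (B D : 'I_2) : S :=
  let: And3 sG _ _ := hG in CSFun (sG a.1 a.2 B D).

Lemma GamE a B D p : Gam a B D p = G a.1 a.2 B D p.
Proof. by rewrite /Gam; case: hG. Qed.

Definition Gamb (a : I) (B D : 'I_2) : S := csfun_conj (Gam (a.2, a.1) B D).

Lemma GambE a B D p : Gamb a B D p = (G a.2 a.1 B D p)^*%C.
Proof. by rewrite -(GamE (a.2, a.1)). Qed.

(** The bracket of two frame vectors is nabla_a e_b - nabla_b e_a for a torsion-free connection,
    which yields these coefficients. *)
Definition struc (a b e : I) : S :=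
  (e.2 == b.2)%:R * Gam a b.1 e.1 + (e.1 == b.1)%:R * Gamb a b.2 e.2
  - (e.2 == a.2)%:R * Gam b a.1 e.1 - (e.1 == a.1)%:R * Gamb b a.2 e.2.

Lemma ord2 (A : 'I_2) : A = 0 \/ A = 1.
Proof. by case: A => -[|[|//]] lA; [left|right]; exact: val_inj. Qed.

Lemma sum_struc a b (x : I -> S) :
  \sum_e struc a b e * x e =
  \sum_X Gam a b.1 X * x (X, b.2) + \sum_X Gamb a b.2 X * x (b.1, X)
  - \sum_X Gam b a.1 X * x (X, a.2) - \sum_X Gamb b a.2 X * x (a.1, X).
Proof.
rewrite sum22 !sum2 /struc; case: a b => [A A'] [B B'] /=.
by case: (ord2 A) => ->; case: (ord2 A') => ->; case: (ord2 B) => ->;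
  case: (ord2 B') => ->; rewrite /=; ring.
Qed.

Lemma struc_antisym a b e : struc b a e = - struc a b e.
Proof. by rewrite /struc; ring. Qed.

Lemma Gam_trace0 a : Gam a 1 1 = - Gam a 0 0.
Proof.
apply: csfun_ext => p; rewrite csfunE !GamE; case: hG => _ G0 _.
have := G0 a.1 a.2 0 1 p.
rewrite /nabla20 /conn !sum2 !epsE (sigma_cst hE.1) => T.
by rewrite -[LHS]addr0 -T; ring.
Qed.

Lemma Gamb_trace0 a : Gamb a 1 1 = - Gamb a 0 0.
Proof.
apply: csfun_ext => p; rewrite csfunE !GambE -(GamE (a.2, a.1)) Gam_trace0.
by rewrite csfunE GamE rmorphN.
Qed.

Lemma der_commutator a b f :
  der a (der b f) - der b (der a f) = \sum_e struc a b e * der e f.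
Proof.
apply: csfun_ext => p; rewrite sum_struc !sum2 !csfunE !(GamE, GambE).
case: hG => _ _ /(_ f (csfunP f) a.1 a.2 b.1 b.2 p).
rewrite /nabla11 /conn /connb !sum2 => T.
rewrite /der /= -!/(sigma _ _ _ _ _).
move/eqP: T; rewrite -subr_eq0 => /eqP T; apply/eqP; rewrite -subr_eq0.
by rewrite -[X in _ == X]T; apply/eqP; ring.
Qed.

Lemma der_independent (k : I -> S) :
  (forall f, \sum_e k e * der e f = 0) -> forall e, k e = 0.
Proof.
move=> k0 [A A']; apply: csfun_ext => p.
apply: (sigma_independent hg hE (p := p) (k := fun A A' => k (A, A') p)).
move=> f sf; have := congr1 (fun h : S => h p) (k0 (CSFun sf)).
by rewrite sum22.
Qed.

Definition curv := curvature der struc Gam.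
Definition curvb := curvature der struc Gamb.

Lemma curv_antisym a b B D : curv b a B D = - curv a b B D.
Proof. by apply: curvature_antisym => e; exact: struc_antisym. Qed.

Lemma curvb_antisym a b B D : curvb b a B D = - curvb a b B D.
Proof. by apply: curvature_antisym => e; exact: struc_antisym. Qed.

Lemma curv_trace0 a b : curv a b 1 1 = - curv a b 0 0.
Proof. by apply: curvature_trace0 => *; [exact: derD|exact: Gam_trace0]. Qed.

Lemma curvb_trace0 a b : curvb a b 1 1 = - curvb a b 0 0.
Proof. by apply: curvature_trace0 => *; [exact: derD|exact: Gamb_trace0]. Qed.

Lemma nabla10E (k : 'I_2 -> S) A A' B :
  nabla10 E G (fun B => k B) A A' B = cov der Gam (A, A') k B.
Proof.
apply/funext => p; rewrite /nabla10 /conn /cov !sum2 !csfunE !GamE.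
by [].
Qed.


Lemma covE A A' (u : 'I_2 -> S) D p : cov der Gam (A, A') u D p =
  sigma E A A' (u D) p - (G A A' D 0 p * u 0 p + G A A' D 1 p * u 1 p).
Proof. by rewrite -nabla10E /nabla10 /conn sum2. Qed.

Lemma nabla11E (w : 'I_2 -> 'I_2 -> S) A A' B B' :
  nabla11 E G (fun B B' => w B B') A A' B B' = cov11 der Gam Gamb (A, A') w B B'.
Proof.
apply/funext => p; rewrite /nabla11 /conn /connb /cov11 !sum2 !csfunE.
by rewrite !(GamE, GambE).
Qed.

Lemma cov11E A A' (u : 'I_2 -> 'I_2 -> S) D D' p :
  cov11 der Gam Gamb (A, A') u D D' p =
  sigma E A A' (u D D') p
  - (G A A' D 0 p * u 0 D' p + G A A' D 1 p * u 1 D' p)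
  - ((G A' A D' 0 p)^*%C * u D 0 p + (G A' A D' 1 p)^*%C * u D 1 p).
Proof. by rewrite -nabla11E /nabla11 /conn /connb !sum2. Qed.

(** The connection terms on the pair BB' are those collected in [struc], so they cancel the
    structure functions of [cov_commutator] and leave curvature alone. *)
Lemma nabla21_commutator (k : 'I_2 -> M -> C) : (forall B, csmooth (k B)) ->
  forall A A' B B' D p,
  nabla21 E G (nabla10 E G k) A A' B B' D p
  - nabla21 E G (nabla10 E G k) B B' A A' D p =
  \sum_X curv (A, A') (B, B') D X p * k X p.
Proof.
move=> sk A A' B B' D p; pose kS B : S := CSFun (sk B).
have nE : nabla10 E G k = fun A A' B => cov der Gam (A, A') kS B :> (M -> C).
  by apply/funext => X; apply/funext => Y; apply/funext => Z; rewrite -nabla10E.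
have := cov_commutator derD derM der_commutator Gam (A, A') (B, B') kS D.
have := covE A A' (cov der Gam (B, B') kS) D p.
have := covE B B' (cov der Gam (A, A') kS) D p.
rewrite nE /nabla21 /conn /connb !sum2 sum_struc -/curv.
(* [cov] and [curv] are generalized because [csfunE] would unfold them. *)
move: (cov der Gam) curv => cv cu e2 e1 /(congr1 (fun h : S => h p)).
rewrite !sum2 !csfunE e1 e2 !(GamE, GambE) /= => H.
move/eqP: H; rewrite -subr_eq0 => /eqP H; apply/eqP; rewrite -subr_eq0.
by rewrite -[X in _ == X]H; apply/eqP; ring.
Qed.



Lemma nabla22_commutator (w : 'I_2 -> 'I_2 -> M -> C) :
  (forall B B', csmooth (w B B')) -> forall A A' B B' D D' p,
  nabla22 E G (nabla11 E G w) A A' B B' D D' p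
  - nabla22 E G (nabla11 E G w) B B' A A' D D' p =
  \sum_X curv (A, A') (B, B') D X p * w X D' p
  + \sum_X curvb (A, A') (B, B') D' X p * w D X p.
Proof.
move=> sw A A' B B' D D' p; pose wS B B' : S := CSFun (sw B B').
have nE : nabla11 E G w =
    fun A A' B B' => cov11 der Gam Gamb (A, A') wS B B' :> (M -> C).
  apply/funext => X; apply/funext => Y; apply/funext => Z.
  by apply/funext => Z'; rewrite -nabla11E.
have := cov11_commutator derD derM der_commutator Gam Gamb (A, A') (B, B') wS D D'.
have := cov11E A A' (cov11 der Gam Gamb (B, B') wS) D D' p.
have := cov11E B B' (cov11 der Gam Gamb (A, A') wS) D D' p.
rewrite nE /nabla22 /conn /connb !sum2 sum_struc -/curv -/curvb.
move: (cov11 der Gam Gamb) curv curvb => cv cu cub e2 e1.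
move/(congr1 (fun h : S => h p)).
rewrite !sum2 !csfunE e1 e2 !(GamE, GambE) /= => H.
move/eqP: H; rewrite -subr_eq0 => /eqP H; apply/eqP; rewrite -subr_eq0.
by rewrite -[X in _ == X]H; apply/eqP; ring.
Qed.

Variable Rm : I -> I -> I -> I -> M -> C.
Hypothesis hRm : is_riemann_tensor E G Rm.

(** Testing the Ricci identity on the covector with constant components, 1 at XX' and 0 elsewhere,
    reads off a single component. *)
Lemma riemannE a b D D' X X' p : Rm a b (D, D') (X, X') p =
  - (curv a b D X p * (D' == X')%:R + curvb a b D' X' p * (D == X)%:R).
Proof.
pose w B B' : M -> C := fun=> ((B == X) && (B' == X'))%:R.
have sw B B' : csmooth (w B B') by exact: csmooth_cst.
have := hRm.2 w sw a.1 a.2 b.1 b.2 D D' p.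
rewrite nabla22_commutator // -!surjective_pairing.
have -> : \sum_d Rm a b (D, D') d p * w d.1 d.2 p = Rm a b (D, D') (X, X') p.
  rewrite (bigD1 (X, X')) //= {1}/w !eqxx mulr1 big1 ?addr0 //.
  case=> Y Y' nY; rewrite /w; have [YX|_] := eqVneq Y X; last by rewrite mulr0.
  have [YX'|_] := eqVneq Y' X'; last by rewrite mulr0.
  by case/eqP: nY; rewrite YX YX'.
move=> /(congr1 -%R); rewrite opprK => <-.
rewrite !sum2 /w.
by case: (ord2 D) => ->; case: (ord2 D') => ->; case: (ord2 X) => ->;
  case: (ord2 X') => ->; rewrite /=; ring.
Qed.

(** The Ricci identity is applied to w = df. Since nabla_a nabla_b f is symmetric, the cyclic sum of
    third derivatives cancels, and independence of the e_{AA'} at [p] removes the arbitrary [f]. *)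
Lemma first_bianchi a b c e p :
  Rm a b c e p + Rm b c a e p + Rm c a b e p = 0.
Proof.
case: e => X X'.
apply: (sigma_independent hg hE (p := p) (k := fun X X' =>
  Rm a b c (X, X') p + Rm b c a (X, X') p + Rm c a b (X, X') p)) => f sf.
pose w B B' : M -> C := sigma E B B' f.
have sw B B' : csmooth (w B B') by exact: (csmooth_sigma hE.1).
have sym A A' B B' D D' :
    nabla22 E G (nabla11 E G w) A A' B B' D D' p =
    nabla22 E G (nabla11 E G w) A A' D D' B B' p.
  have T : nabla11 E G w = fun U U' V V' => nabla11 E G w V V' U U'.
    apply/funext => U; apply/funext => U'; apply/funext => V.
    apply/funext => V'; apply/funext => q.
    by case: hG => _ _; exact.
  by rewrite {1}T /nabla22 /conn /connb !sum2; ring.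
have h1 := hRm.2 w sw a.1 a.2 b.1 b.2 c.1 c.2 p.
have h2 := hRm.2 w sw b.1 b.2 c.1 c.2 a.1 a.2 p.
have h3 := hRm.2 w sw c.1 c.2 a.1 a.2 b.1 b.2 p.
move: h1 h2 h3; rewrite -!surjective_pairing !sum22 /=.
rewrite (sym a.1 a.2 c.1 c.2) (sym b.1 b.2 a.1 a.2) (sym c.1 c.2 b.1 b.2).
set n1 := nabla22 _ _ _ _ _ _ _ _ _ _; set n2 := nabla22 _ _ _ _ _ _ _ _ _ _.
set n3 := nabla22 _ _ _ _ _ _ _ _ _ _ => h1 h2 h3.
have : (n1 - n2) + (n3 - n1) + (n2 - n3) = 0 by ring.
rewrite h1 h2 h3 /w => h; apply/eqP; rewrite -oppr_eq0 -h; apply/eqP; ring.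
Qed.

End SpinorCurvature.

(** * Pointwise linear algebra of vacuum curvature *)

Section VacuumCurvature.
Variable R : realType.
Local Notation K := (complex R).
Local Notation I := ('I_2 * 'I_2)%type.
Variables F H : I -> I -> 'I_2 -> 'I_2 -> K.
Hypothesis FN : forall a b C D, F b a C D = - F a b C D.
Hypothesis HN : forall a b C D, H b a C D = - H a b C D.
Hypothesis F_trace0 : forall a b, F a b 1 1 = - F a b 0 0.
Hypothesis H_trace0 : forall a b, H a b 1 1 = - H a b 0 0.

Let Rm a b (c e : I) : K :=
  - (F a b c.1 e.1 * (c.2 == e.2)%:R + H a b c.2 e.2 * (c.1 == e.1)%:R).
Let Bi a b c e := Rm a b c e + Rm b c a e + Rm c a b e.
Let Ric a b := \sum_c Rm a c b c.
Hypothesis bianchi0 : forall a b c e, Bi a b c e = 0.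
Hypothesis ricci0 : forall a b, Ric a b = 0.

Let skew0 (x : K) : x = - x -> x = 0.
Proof.
move=> /eqP; rewrite -subr_eq0 opprK -mulr2n mulrn_eq0 /= => /eqP; exact.
Qed.

Let F0 a C D : F a a C D = 0. Proof. by apply: skew0; rewrite -FN. Qed.
Let H0 a C D : H a a C D = 0. Proof. by apply: skew0; rewrite -HN. Qed.

(** Rewriting with [FN] itself would not terminate; these instances put the two frame labels in
    increasing order. *)
Let reduceF := (F_trace0, F0, FN (0, 0) (0, 1), FN (0, 0) (1, 0),
  FN (0, 0) (1, 1), FN (0, 1) (1, 0), FN (0, 1) (1, 1), FN (1, 0) (1, 1)).
Let reduceH := (H_trace0, H0, HN (0, 0) (0, 1), HN (0, 0) (1, 0),
  HN (0, 0) (1, 1), HN (0, 1) (1, 0), HN (0, 1) (1, 1), HN (1, 0) (1, 1)).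

Let combination (x y : K) : 4 * x = y -> y = 0 -> x = 0.
Proof.
move=> xy y0; apply: (mulfI (x := 4)); first by rewrite pnatr_eq0.
by rewrite xy y0 mulr0.
Qed.

(** The argument is a certificate: four times the component to be killed equals this integer
    combination of Bianchi and Ricci components, identically in the independent components of [F]
    and [H]. *)
Ltac by_combination e :=
  apply: (combination (y := e));
  [ rewrite /Ric ?sum22 /Bi /Rm /= ?reduceF ?reduceH; ring
  | rewrite ?bianchi0 ?ricci0 ?mulr0 ?addr0 ?subr0 //].

Let trace_cases (f : 'I_2 -> 'I_2 -> K) : f 1 1 = - f 0 0 ->
  f 0 0 = 0 -> f 0 1 = 0 -> f 1 0 = 0 -> forall C D, f C D = 0.
Proof.
move=> f11 f00 f01 f10 C D.
by case: (ord2 C) => ->; case: (ord2 D) => ->; rewrite ?f11 ?f00 ?oppr0.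
Qed.

(** The part of [F] skew in AB and symmetric in A'B' is the Ricci spinor. This is its component A'B'
    = 00; [vacuum_phi11] and [vacuum_phi01] treat 11 and 01. *)
Lemma vacuum_phi00 C D : F (0, 0) (1, 0) C D = 0.
Proof.
move: C D; apply: trace_cases => //.
- by_combination (2 * Bi (0, 0) (1, 0) (1, 1) (1, 1) + 2 * Ric (0, 0) (1, 0)).
- by_combination (2 * Bi (0, 0) (0, 1) (1, 0) (1, 1) - 2 * Ric (0, 0) (0, 0)).
- by_combination (2 * Ric (1, 0) (1, 0) - 2 * Bi (0, 0) (1, 0) (1, 1) (0, 1)).
Qed.

Lemma vacuum_phi11 C D : F (0, 1) (1, 1) C D = 0.
Proof.
move: C D; apply: trace_cases => //.
- by_combination (2 * Ric (0, 1) (1, 1) - 2 * Bi (0, 1) (1, 0) (1, 1) (1, 0)).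
- by_combination (- 2 * Ric (0, 1) (0, 1) - 2 * Bi (0, 0) (0, 1) (1, 1) (1, 0)).
- by_combination (2 * Ric (1, 1) (1, 1) + 2 * Bi (0, 1) (1, 0) (1, 1) (0, 0)).
Qed.

Lemma vacuum_phi01 C D : F (0, 1) (1, 0) C D = - F (0, 0) (1, 1) C D.
Proof.
apply/eqP; rewrite -addr_eq0; apply/eqP; move: C D.
apply: trace_cases => [||| ]; first by rewrite !F_trace0; ring.
- by_combination (2 * Ric (0, 0) (1, 1) + 2 * Ric (0, 1) (1, 0)
    + 2 * Bi (0, 1) (1, 0) (1, 1) (1, 1) - 2 * Bi (0, 0) (1, 0) (1, 1) (1, 0)).
- by_combination (- 4 * Ric (0, 0) (0, 1) - 4 * Bi (0, 0) (0, 1) (1, 0) (1, 0)).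
- by_combination (4 * Ric (1, 0) (1, 1) + 4 * Bi (0, 0) (1, 0) (1, 1) (0, 0)).
Qed.

(** Without Ricci spinor, [F] is eps_{A'B'} X_{ABCD} with X symmetric in AB and in CD. This lemma
    and [vacuum_sym1] add the symmetry in BC, which includes the vanishing of the scalar
    curvature. *)
Lemma vacuum_sym0 D : F (0, 0) (0, 1) 1 D = F (0, 0) (1, 1) 0 D.
Proof.
apply/esym/eqP; rewrite -subr_eq0; apply/eqP; case: (ord2 D) => ->.
- by_combination (2 * Ric (0, 0) (1, 1) + Bi (0, 0) (0, 1) (1, 0) (0, 0)
    + Bi (0, 0) (0, 1) (1, 1) (0, 1) - Bi (0, 0) (1, 0) (1, 1) (1, 0)
    + Bi (0, 1) (1, 0) (1, 1) (1, 1)).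
- by_combination (- 2 * Ric (0, 0) (0, 1) + 2 * Bi (0, 0) (0, 1) (1, 1) (1, 1)).
Qed.

Lemma vacuum_sym1 D : F (1, 0) (1, 1) 0 D = F (0, 0) (1, 1) 1 D.
Proof.
apply/esym/eqP; rewrite -subr_eq0; apply/eqP; case: (ord2 D) => ->.
- by_combination (2 * Ric (1, 1) (1, 0) + 2 * Bi (0, 0) (1, 0) (1, 1) (0, 0)).
- by_combination (- 2 * Ric (0, 0) (1, 1) + Bi (0, 0) (0, 1) (1, 0) (0, 0)
    + Bi (0, 0) (0, 1) (1, 1) (0, 1) + 3 * Bi (0, 0) (1, 0) (1, 1) (1, 0)
    + Bi (0, 1) (1, 0) (1, 1) (1, 1)).
Qed.

(** [Y] is 2 X_{ABCD}. As X is already totally symmetric, the symmetrization over three indices that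
    determines [W] loses nothing. *)
Lemma vacuum_curvature (W : 'I_2 -> 'I_2 -> 'I_2 -> 'I_2 -> K) :
  let Y A B C D := F (A, 0) (B, 1) C D + F (B, 0) (A, 1) C D in
  (forall A B C D, Y A B C D + Y A C B D + Y B C A D = 6 * W A B C D) ->
  forall A A' B B' C D, F (A, A') (B, B') C D = eps R A' B' * W A B C D.
Proof.
move=> Y YW A A' B B' C D.
have six0 : 6 != 0 :> K by rewrite pnatr_eq0.
apply: (mulfI six0); rewrite mulrCA -YW /Y {Y YW}.
have s00 : F (0, 0) (0, 1) 0 0 = - F (0, 0) (1, 1) 0 1.
  by rewrite -vacuum_sym0 F_trace0 opprK.
have s10 : F (0, 0) (0, 1) 1 0 = F (0, 0) (1, 1) 0 0 by exact: vacuum_sym0.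
have s01 : F (1, 0) (1, 1) 0 1 = - F (0, 0) (1, 1) 0 0.
  by rewrite vacuum_sym1 F_trace0.
have s11 : F (1, 0) (1, 1) 0 0 = F (0, 0) (1, 1) 1 0 by exact: vacuum_sym1.
by case: (ord2 A) => ->; case: (ord2 A') => ->; case: (ord2 B) => ->;
  case: (ord2 B') => ->; case: (ord2 C) => ->; case: (ord2 D) => ->;
  rewrite !epsE ?reduceF ?vacuum_phi00 ?vacuum_phi11 ?vacuum_phi01 ?F_trace0
    ?s00 ?s10 ?s01 ?s11; ring.
Qed.

End VacuumCurvature.

(** * The Weyl spinor as the whole curvature, and its vanishing divergence *)

Section VacuumBianchi.
Variables (R : realType) (M : manifold4 R).
Local Notation C := (complex R).
Local Notation I := ('I_2 * 'I_2)%type.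
Variables (g : M -> tvec M -> tvec M -> R) (hg : lorentzian_metric g).
Variables (E : 'I_4 -> M -> tvec M) (hE : orthonormal_tetrad g E).
Variables (G : 'I_2 -> 'I_2 -> 'I_2 -> 'I_2 -> M -> C).
Hypothesis hG : levi_civita_spinor_derivative E G.
Variable Rm : I -> I -> I -> I -> M -> C.
Hypothesis hRm : is_riemann_tensor E G Rm.
Hypothesis vacuum : forall a b p, ricci Rm a b p = 0.
Variable Psi : 'I_2 -> 'I_2 -> 'I_2 -> 'I_2 -> M -> C.
Hypothesis hPsi : is_weyl_spinor E G Psi.

Local Notation S := (csfun M).
Local Notation Gam := (Gam hG).
Local Notation der := (der hE).
Local Notation curv := (curv hE hG).

Lemma raiseE (k : 'I_2 -> C) : (raise k 0 = k 1) * (raise k 1 = - k 0).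
Proof. by rewrite /raise !sum2 !epsE; split; ring. Qed.

Lemma curv_weyl A A' B B' D F p : curv (A, A') (B, B') D F p =
  eps R A' B' * - raise (fun X => Psi A B D X p) F.
Proof.
pose cu a b X Y := curv a b X Y p; pose cub a b X Y := curvb hE hG a b X Y p.
apply: (@vacuum_curvature R cu cub _ _ _ _ _ _
    (fun A B D F => - raise (fun X => Psi A B D X p) F)).
- by move=> a b X Y; rewrite /cu curv_antisym.
- by move=> a b X Y; rewrite /cub curvb_antisym.
- by move=> a b; rewrite /cu curv_trace0.
- by move=> a b; rewrite /cub curvb_trace0.
- move=> a b c e; have := first_bianchi hg hE hG hRm a b c e p.
  by case: c => X X'; case: e => Y Y'; case: a => Z Z'; case: b => T T';
    rewrite !(riemannE hE hG hRm).
- move=> a b; have := vacuum a b p; rewrite /ricci !sum22.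
  by case: b => T T'; rewrite !(riemannE hE hG hRm).
move=> {A A' B B' D F} A B D F.
case: hPsi => _ _ weyl.
pose k X : M -> C := fun=> (X == F)%:R.
have sk X : csmooth (k X) by exact: csmooth_cst.
have N := nabla21_commutator hE hG sk.
have kE (f : 'I_2 -> C) : \sum_X f X * k X p = f F.
  rewrite sum2 /k; case: (ord2 F) => -> /=; ring.
have := weyl k sk A B D p; rewrite kE /sym3 !sum2 !epsE => w.
have six0 : 6 != 0 :> C by rewrite pnatr_eq0.
have {}N X X' Y Y' Z : cu (X, X') (Y, Y') Z F =
  nabla21 E G (nabla10 E G k) X X' Y Y' Z p
  - nabla21 E G (nabla10 E G k) Y Y' X X' Z p.
  by rewrite N kE.
rewrite -w !N mulrC divfK //; ring.
Qed.

Let sPsi : forall A B D F, csmooth (Psi A B D F).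
Proof. by case: hPsi. Qed.

Definition weyl_csfun A B D F : S := CSFun (sPsi A B D F).
Local Notation W := weyl_csfun.

Lemma weyl_sym : (forall D F, W 1 0 D F = W 0 1 D F) *
  (forall A F, W A 1 0 F = W A 0 1 F) * (forall A B, W A B 1 0 = W A B 0 1).
Proof.
case: hPsi => _ sym _; split; [split|] => X Y; apply: csfun_ext => p /=;
  by rewrite sym [RHS]sym /sym4 /sym3; ring.
Qed.

(** The components of -Psi_{ABD}^F, through which the curvature acts on lower-index spinors. *)
Definition lower_weyl (A B D F : 'I_2) : S := if F == 0 then - W A B D 1 else W A B D 0.
Definition eps_csfun (A B : 'I_2) : S :=
  if A == B then 0 else if A == 0 then 1 else -1.

Lemma curv_csfun A A' B B' D F :
  curv (A, A') (B, B') D F = eps_csfun A' B' * lower_weyl A B D F.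
Proof.
apply: csfun_ext => p; rewrite curv_weyl csfunE; congr (_ * _).
  by rewrite /eps /eps_csfun; case: eqP => // _; case: eqP.
by rewrite /lower_weyl; case: (ord2 F) => ->; rewrite raiseE ?opprK.
Qed.

Definition nabla40 (T : 'I_2 -> 'I_2 -> 'I_2 -> 'I_2 -> M -> C)
    (A A' B D F H : 'I_2) (p : M) : C :=
  sigma E A A' (T B D F H) p
  - conn G A A' p (fun X => T X D F H p) B
  - conn G A A' p (fun X => T B X F H p) D
  - conn G A A' p (fun X => T B D X H p) F
  - conn G A A' p (fun X => T B D F X p) H.

Lemma weyl_divergence_free A' B D F p :
  nabla40 Psi 1 A' 0 B D F p = nabla40 Psi 0 A' 1 B D F p.
Proof.
pose n a X Y Z T : S := der a (W X Y Z T)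
  - (Gam a X 0 * W 0 Y Z T + Gam a X 1 * W 1 Y Z T)
  - (Gam a Y 0 * W X 0 Z T + Gam a Y 1 * W X 1 Z T)
  - (Gam a Z 0 * W X Y 0 T + Gam a Z 1 * W X Y 1 T)
  - (Gam a T 0 * W X Y Z 0 + Gam a T 1 * W X Y Z 1).
have nE X X' Y Z T U : nabla40 Psi X X' Y Z T U p = n (X, X') Y Z T U p.
  by rewrite /nabla40 /conn !sum2 /n !csfunE !(GamE hG).
rewrite !nE; apply: (congr1 (fun f : S => f p)) => {p nE}.
have B2 := second_bianchi (derD hE) (derM hE) (der_commutator hE hG)
   (der_independent hg (hE := hE)) Gam.
have G0 := Gam_trace0 hE hG; have Gb0 := Gamb_trace0 hE hG.
apply/eqP; rewrite -subr_eq0; apply/eqP.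
(* Two labels share A', so the curvature between them vanishes and the two other cyclic terms give
   the two derivatives in the claim. The column 1 - F undoes the raising of the last index. *)
move: (B2 (0, A') (1, A') (B, 1 - A') D (1 - F)) => {B2}.
rewrite /dcurvature -/(curv) !sum22 !sum2 /n {n}.
have derE : (forall a f, der a (1 * f) = der a f) *
    (forall a f, der a (0 * f) = 0) * (forall a f, der a (-1 * f) = - der a f)
    * (forall a f, der a (- f) = - der a f).
  split; [split; [split|]|] => a f; rewrite ?mul1r ?mul0r ?mulN1r //.
  - exact: der0 (derD hE) a.
  - exact: derN (derD hE) a f.
  - exact: derN (derD hE) a f.
have o1 : 1 - 1 = 0 :> 'I_2 by exact: val_inj.
have o0 : 1 - 0 = 1 :> 'I_2 by exact: val_inj.
case: (ord2 A') => ->; case: (ord2 B) => ->; case: (ord2 D) => ->;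
  case: (ord2 F) => ->; rewrite !(o0, o1) !curv_csfun /eps_csfun /lower_weyl
    /struc /= !weyl_sym !Gb0 !G0 => h.
all: rewrite ?derE in h.
all: first [rewrite -[RHS]oppr0 -[in RHS]h; ring | rewrite -[RHS]h; ring].
Qed.

End VacuumBianchi.

(** * Product rules for covariant derivatives of spinor fields *)

Section Leibniz.
Variables (R : realType) (M : manifold4 R).
Local Notation C := (complex R).
Variables (E : 'I_4 -> M -> tvec M).
Hypothesis vE : forall j, smooth_vfield (E j).
Variables (G : 'I_2 -> 'I_2 -> 'I_2 -> 'I_2 -> M -> C).
Hypothesis sG : forall A A' B D, csmooth (G A A' B D).
Hypothesis G_trace0 : forall A A' p, G A A' 1 1 p = - G A A' 0 0 p.

Let sM := sigmaM vE.
Let sD := sigmaD vE.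

Lemma csmooth_nabla10 (k : 'I_2 -> M -> C) A A' B :
  (forall B, csmooth (k B)) -> csmooth (nabla10 E G k A A' B).
Proof.
move=> sk; apply: csmoothD; first exact: csmooth_sigma.
apply: csmoothN; apply: csmooth_sum => D; exact: csmoothM.
Qed.

Lemma nabla40_product (u : M -> C) (a b c d : 'I_2 -> M -> C) A A' B D F H p :
  csmooth u -> (forall X, csmooth (a X)) -> (forall X, csmooth (b X)) ->
  (forall X, csmooth (c X)) -> (forall X, csmooth (d X)) ->
  nabla40 E G (fun B D F H q => u q * (a B q * (b D q * (c F q * d H q))))
    A A' B D F H p =
  sigma E A A' u p * (a B p * (b D p * (c F p * d H p)))
  + u p * (nabla10 E G a A A' B p * (b D p * (c F p * d H p))
    + a B p * (nabla10 E G b A A' D p * (c F p * d H p)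
      + b D p * (nabla10 E G c A A' F p * d H p
                 + c F p * nabla10 E G d A A' H p))).
Proof.
move=> su sa sb sc sd.
rewrite /nabla40 /nabla10 /conn !sum2 !sM //; do ?[exact: csmoothM|apply: csmoothM => //].
by ring.
Qed.

Lemma nabla40D T U A A' B D F H p :
  (forall B D F H, csmooth (T B D F H)) ->
  (forall B D F H, csmooth (U B D F H)) ->
  nabla40 E G (fun B D F H q => T B D F H q + U B D F H q) A A' B D F H p =
  nabla40 E G T A A' B D F H p + nabla40 E G U A A' B D F H p.
Proof. by move=> sT sU; rewrite /nabla40 /conn !sum2 !sD //; ring. Qed.

Lemma nabla31_product u (k : 'I_2 -> M -> C) (t : 'I_2 -> 'I_2 -> 'I_2 -> M -> C)
  A A' B D F F' p :
  csmooth u -> (forall X, csmooth (k X)) ->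
  (forall X Y Z, csmooth (t X Y Z)) ->
  nabla31 E G (fun B D F F' q => u q * (k B q * t D F' F q)) A A' B D F F' p =
  sigma E A A' u p * (k B p * t D F' F p)
  + u p * (nabla10 E G k A A' B p * t D F' F p
           + k B p * nabla21 E G t A A' D F' F p).
Proof.
move=> su sk st.
rewrite /nabla31 /nabla10 /nabla21 /conn /connb !sum2 !sM //; try exact: csmoothM.
by ring.
Qed.

Lemma nabla21_product (k : 'I_2 -> M -> C) (w : 'I_2 -> 'I_2 -> M -> C)
  A A' B B' D p :
  (forall X, csmooth (k X)) -> (forall X Y, csmooth (w X Y)) ->
  nabla21 E G (fun B B' D q => k B q * w D B' q) A A' B B' D p =
  nabla10 E G k A A' B p * w D B' p + k B p * nabla11 E G w A A' D B' p.
Proof.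
move=> sk sw.
rewrite /nabla21 /nabla10 /nabla11 /conn /connb !sum2 !sM //.
by ring.
Qed.

(* The field is k^D t_{BB'D}; trace-freeness makes the raising spinor
   covariantly constant. *)
Lemma nabla11_contraction (k : 'I_2 -> M -> C)
  (t : 'I_2 -> 'I_2 -> 'I_2 -> M -> C) A A' B B' p :
  (forall X, csmooth (k X)) -> (forall X Y Z, csmooth (t X Y Z)) ->
  nabla11 E G (fun B B' q => k 1 q * t B B' 0 q + -1 * (k 0 q * t B B' 1 q))
    A A' B B' p =
  nabla10 E G k A A' 1 p * t B B' 0 p - nabla10 E G k A A' 0 p * t B B' 1 p
  + k 1 p * nabla21 E G t A A' B B' 0 p - k 0 p * nabla21 E G t A A' B B' 1 p.
Proof.
move=> sk st.
have m1 : csmooth (fun _ : M => -1 : C) by exact: csmooth_cst.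
rewrite /nabla21 /nabla10 /nabla11 /conn /connb !sum2 !sD; first last.
- by apply: csmoothM => //; exact: csmoothM.
- exact: csmoothM.
rewrite !sM //; try exact: csmoothM.
by rewrite (sigma_cst vE) !G_trace0; ring.
Qed.

Lemma nabla31_sym3 (T : 'I_2 -> 'I_2 -> 'I_2 -> 'I_2 -> M -> C)
  A A' B D F F' p : (forall B D F F', csmooth (T B D F F')) ->
  nabla31 E G (fun B D F F' q => sym3 (fun B D F => T B D F F' q) B D F)
    A A' B D F F' p =
  sym3 (fun B D F => nabla31 E G T A A' B D F F' p) B D F.
Proof.
move=> sT; rewrite /sym3.
have c6 : csmooth (fun _ : M => 6^-1 : C) by exact: csmooth_cst.
rewrite /nabla31 /conn /connb !sum2 !sM ?(sigma_cst vE) ?mulr0 ?addr0 //.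
  rewrite !sD //; last 5 first; do ?[exact: csmoothD|apply: csmoothD => //].
  by ring.
by do ?[exact: csmoothD|apply: csmoothD => //].
Qed.

Lemma nabla31B T U A A' B D F F' p :
  (forall B D F H, csmooth (T B D F H)) ->
  (forall B D F H, csmooth (U B D F H)) ->
  nabla31 E G (fun B D F H q => T B D F H q + -1 * U B D F H q) A A' B D F F' p =
  nabla31 E G T A A' B D F F' p - nabla31 E G U A A' B D F F' p.
Proof.
move=> sT sU; rewrite /nabla31 /conn /connb !sum2.
have m1 : csmooth (fun _ : M => -1 : C) by exact: csmooth_cst.
rewrite !sD //; last by exact: csmoothM.
by rewrite !sM // (sigma_cst vE); ring.
Qed.

Lemma curlE L A B D F p : curl E G L A B D F p =
  nabla31 E G L A 1 B D F 0 p - nabla31 E G L A 0 B D F 1 p.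
Proof. by rewrite /curl sum2 !raiseE. Qed.

Lemma sigmaV f A A' p : csmooth f -> (forall p, f p != 0) ->
  sigma E A A' (fun q => (f q)^-1) p = - (f p)^-1 ^+ 2 * sigma E A A' f p.
Proof.
move=> sf f0; have := sM A A' p sf (csmoothV f0 sf).
have -> : (fun q => f q * (f q)^-1) = fun=> 1.
  by apply/funext => q; rewrite divff.
rewrite (sigma_cst vE) => e; apply: (mulfI (f0 p)).
have fv : f p * (f p)^-1 = 1 by rewrite divff.
move: e fv; set y := sigma _ _ _ (fun q => (f q)^-1) _.
set v := (f p)^-1 => e fv.
have -> : f p * y = (sigma E A A' f p * v + f p * y) - sigma E A A' f p * v.
  by rewrite addrAC subrr add0r.
rewrite -e; ring: fv.
Qed.

End Leibniz.

(** * Identities between symmetrizations *)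

Section Symmetrization.
Variable R : realType.
Local Notation C := (complex R).
Implicit Type V : 'I_2 -> 'I_2 -> 'I_2 -> 'I_2 -> C.

Lemma sym3_sym3 (T : 'I_2 -> 'I_2 -> 'I_2 -> C) A B D :
  sym3 (sym3 T) A B D = sym3 T A B D.
Proof.
have six0 : 6 != 0 :> C by rewrite pnatr_eq0.
rewrite /sym3 -!mulrDl; congr (_ / _).
by apply: (canLR (mulfK six0)); ring.
Qed.

Lemma sym4_sym3 V A B D F :
  sym4 (fun A B D F => sym3 (fun B D F => V A B D F) B D F) A B D F =
  sym4 V A B D F.
Proof. by rewrite /sym4 !(sym3_sym3 (V _)). Qed.

(** In the curl, the two derivative indices of a second derivative stand in slots 1 and 3. Only the
    part symmetric in them survives, and that part is the curvature operator. *)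
Lemma sym4_average13 V W A B D F :
  (forall A B D F, V A B D F + V D B A F = 2 * W A B D F) ->
  sym4 V A B D F = sym4 W A B D F.
Proof.
move=> VW; have two0 : 2 != 0 :> C by rewrite pnatr_eq0.
have WE X Y Z T : W X Y Z T = (V X Y Z T + V Z Y X T) / 2.
  by rewrite VW mulrC mulKf.
by rewrite /sym4 /sym3 !WE; field.
Qed.

Lemma sym4_swap34 V A B D F :
  sym4 (fun A B D F => V A B F D) A B D F = sym4 V A B D F.
Proof. by rewrite /sym4 /sym3; ring. Qed.

End Symmetrization.

(** * Consequences of the divergence equation at a point, for one value of A' *)

Section Dyad.
Variable R : realType.
Local Notation K := (complex R).
Variables o i : 'I_2 -> K.
Hypothesis norm : o 0 * i 1 = 1 + o 1 * i 0.

(** This is 6 o_(A o_B i_D i_F), so that its coefficient in Psi is Psi_2 itself. *)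
Definition ooii (A B D F : 'I_2) : K :=
  o A * o B * i D * i F + o A * i B * o D * i F + o A * i B * i D * o F
  + i A * o B * o D * i F + i A * o B * i D * o F + i A * i B * o D * o F.

(* The value of nabla_E on [ooii] when [O] and [J] are those of nabla_E on
   [o] and [i]. *)
Definition dooii (O J : 'I_2 -> K) (A B D F : 'I_2) : K :=
  let term (a b c d da db dc dd : 'I_2 -> K) :=
    da A * b B * c D * d F + a A * db B * c D * d F
    + a A * b B * dc D * d F + a A * b B * c D * dd F in
  term o o i i O O J J + term o i o i O J O J + term o i i o O J J O
  + term i o o i J O O J + term i o i o J O J O + term i i o o J J O O.

Variables (f : K) (df : 'I_2 -> K) (O J : 'I_2 -> 'I_2 -> K).
Hypothesis f0 : f != 0.
Hypothesis dnorm : forall E,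
  O E 0 * i 1 + o 0 * J E 1 = O E 1 * i 0 + o 1 * J E 0.
(** This is nabla_{AA'} of f^3 [ooii] with first index 1 - A, divided by f^2; [bianchi] is thus the
    divergence equation without its common factor. *)
Let div A B D F := 3 * df A * ooii (1 - A) B D F
  + f * dooii (O A) (J A) (1 - A) B D F.
Hypothesis bianchi : forall B D F, div 1 B D F = div 0 B D F.

(** With raised indices, [dot k l] is k_A l^A and [dot2 T k l] is T_{AB} k^A l^B. *)
Definition dot (k l : 'I_2 -> K) := k 0 * l 1 - k 1 * l 0.
Definition dot2 (T : 'I_2 -> 'I_2 -> K) (k l : 'I_2 -> K) :=
  dot (fun A => dot (T A) l) k.

Let contract (a b c : 'I_2 -> K) A :=
  dot (fun B => dot (fun D => dot (div A B D) c) b) a.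

Let contract_bianchi a b c : contract a b c 1 = contract a b c 0.
Proof. by rewrite /contract /dot !bianchi. Qed.

Lemma dual_dyad (T : 'I_2 -> 'I_2 -> K) A B : T A B =
  dot2 T i i * (o A * o B) - dot2 T i o * (o A * i B)
  - dot2 T o i * (i A * o B) + dot2 T o o * (i A * i B).
Proof.
rewrite /dot2 /dot.
by case: (ord2 A) => ->; case: (ord2 B) => ->; ring: norm.
Qed.

Let o1 : 1 - 1 = 0 :> 'I_2. Proof. exact: val_inj. Qed.
Let o0 : 1 - 0 = 1 :> 'I_2. Proof. exact: val_inj. Qed.

Let three_kill (x y : K) : y = 0 -> 3 * x = y -> x = 0.
Proof.
by move=> -> /eqP; rewrite mulf_eq0 pnatr_eq0 => /eqP.
Qed.

Let contract0 a b c : contract a b c 0 - contract a b c 1 = 0.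
Proof. by rewrite contract_bianchi subrr. Qed.

Let dn E : dot (O E) i - dot (J E) o = 0.
Proof.
rewrite /dot; apply/eqP; rewrite subr_eq add0r subr_eq; apply/eqP.
have -> : J E 0 * o 1 - J E 1 * o 0 + O E 1 * i 0 =
  O E 1 * i 0 + o 1 * J E 0 - o 0 * J E 1 by ring.
by rewrite -dnorm; ring.
Qed.

(** [ooii] contracted with three [o] vanishes, so [df] disappears and 3 f o^A o^B O_{AB} remains.
    The two values of A' give the geodesic and the shear-free condition. *)
Lemma principal_geodesic_o : dot2 O o o = 0.
Proof.
apply: (mulfI f0); rewrite mulr0; apply: three_kill (contract0 o o o) _.
rewrite /contract /div /dot !(o0, o1) /ooii /dooii /dot2 /dot.
ring: norm.
Qed.

Lemma principal_geodesic_i : dot2 J i i = 0.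
Proof.
apply: (mulfI f0); rewrite mulr0; apply: three_kill (contract0 i i i) _.
rewrite /contract /div /dot !(o0, o1) /ooii /dooii /dot2 /dot.
ring: norm.
Qed.

Lemma dot_df_o : dot df o - f * dot2 O i o = 0.
Proof.
(* The extra terms are the derivative of the normalization contracted with [o]; they trade
   derivatives of [i] for derivatives of [o]. *)
have e : (contract o o i 0 - contract o o i 1)
   + 2 * f * (o 0 * (dot (O 1) i - dot (J 1) o))
   - 2 * f * (o 1 * (dot (O 0) i - dot (J 0) o)) = 0.
  by rewrite !dn contract0 !mulr0 addr0 subr0.
apply: three_kill e _.
rewrite /contract /div /dot !(o0, o1) /ooii /dooii /dot2 /dot.
ring: norm.
Qed.

Lemma dot_df_i : dot df i + f * dot2 J o i = 0.
Proof.
have e : (contract i i o 1 - contract i i o 0)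
   + 2 * f * (i 0 * (dot (O 1) i - dot (J 1) o))
   - 2 * f * (i 1 * (dot (O 0) i - dot (J 0) o)) = 0.
  by rewrite !dn contract_bianchi subrr !mulr0 addr0 subr0.
apply: three_kill e _.
rewrite /contract /div /dot !(o0, o1) /ooii /dooii /dot2 /dot.
ring: norm.
Qed.

(** Of the eight dyad components of [O] and [J], the normalization identifies two pairs and the
    geodesic equations kill two. Four are left, two of which determine [df]. *)
Lemma dyad_derivatives : let x1 := dot2 O i i in let x2 := - dot2 O i o in
  let x3 := - dot2 O o i in let y3 := - dot2 J o i in
  [/\ forall A B, O A B = x1 * (o A * o B) + x2 * (o A * i B) + x3 * (i A * o B),
      forall A B, J A B = - x1 * (o A * i B) + y3 * (i A * o B) - x3 * (i A * i B)
    & forall A, df A = f * (y3 * o A + x2 * i A)].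
Proof.
have J1 : dot2 J i o = dot2 O i i.
  by rewrite /dot2 /dot; have := dn 0; have := dn 1; rewrite /dot;
    move=> /eqP; rewrite subr_eq0 => /eqP -> /eqP; rewrite subr_eq0 => /eqP ->.
have J2 : dot2 J o o = dot2 O o i.
  by rewrite /dot2 /dot; have := dn 0; have := dn 1; rewrite /dot;
    move=> /eqP; rewrite subr_eq0 => /eqP -> /eqP; rewrite subr_eq0 => /eqP ->.
move=> x1 x2 x3 y3; split=> [A B|A B|A].
- by rewrite [LHS]dual_dyad principal_geodesic_o /x1 /x2 /x3; ring.
- by rewrite [LHS]dual_dyad principal_geodesic_i J1 J2 /x1 /x3 /y3; ring.
have -> : df A = dot df i * o A - dot df o * i A.
  by rewrite /dot; case: (ord2 A) => ->; ring: norm.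
move/eqP: dot_df_o; rewrite subr_eq0 => /eqP ->.
move/eqP: dot_df_i; rewrite addr_eq0 => /eqP ->.
by rewrite /x2 /y3; ring.
Qed.

End Dyad.

(** * Elimination of second derivatives from the symmetrized curl *)

Section SymmetrizedCurl.
Variables (R : realType) (M : manifold4 R).
Local Notation C := (complex R).
Variables (E : 'I_4 -> M -> tvec M).
Hypothesis vE : forall j, smooth_vfield (E j).
Variables (G : 'I_2 -> 'I_2 -> 'I_2 -> 'I_2 -> M -> C).
Hypothesis sG : forall A A' B D, csmooth (G A A' B D).
Hypothesis G_trace0 : forall A A' p, G A A' 1 1 p = - G A A' 0 0 p.
Variable Psi : 'I_2 -> 'I_2 -> 'I_2 -> 'I_2 -> M -> C.
Hypothesis box : forall k : 'I_2 -> M -> C, (forall A, csmooth (k A)) ->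
  forall A B D p, let N A A' B B' := nabla21 E G (nabla10 E G k) A A' B B' D p in
  (N A 1 B 0 - N A 0 B 1) + (N B 1 A 0 - N B 0 A 1) =
  2 * (Psi A B D 1 p * k 0 p - Psi A B D 0 p * k 1 p).

Lemma sym4_box (V P Q W : 'I_2 -> 'I_2 -> 'I_2 -> 'I_2 -> C) A B D F :
  (forall A B D F, V A B D F = P A B D F + Q A B D F) ->
  (forall A B D F, Q A B D F + Q D B A F = 2 * W A B D F) ->
  sym4 V A B D F = sym4 (fun A B D F => P A B D F + W A B D F) A B D F.
Proof.
move=> VE QW; rewrite [in RHS]/sym4 /sym3.
have -> : sym4 V A B D F = sym4 P A B D F + sym4 Q A B D F.
  by rewrite /sym4 /sym3 !VE; ring.
rewrite (sym4_average13 (V := Q) (W := W)) // /sym4 /sym3; ring.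
Qed.

Variables (u : M -> C) (k l : 'I_2 -> M -> C).
Hypotheses (su : csmooth u) (sk : forall A, csmooth (k A))
  (sl : forall A, csmooth (l A)).

Let Z A B D p := Psi A B D 1 p * l 0 p - Psi A B D 0 p * l 1 p.

Definition field1 (B D F F' : 'I_2) (q : M) : C :=
  u q * (k B q * nabla10 E G l D F' F q).

Lemma csmooth_field1 B D F F' : csmooth (field1 B D F F').
Proof.
apply: csmoothM => //; apply: csmoothM => //; exact: csmooth_nabla10.
Qed.

(** The curl of [field1] with the second derivatives of [l] replaced by their curvature value [Z];
    it agrees with the curl after symmetrization only. *)
Definition curl_part1 (A B D F : 'I_2) (p : M) : C :=
  k B p * (sigma E A 1 u p * nabla10 E G l D 0 F p
           - sigma E A 0 u p * nabla10 E G l D 1 F p)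
  + u p * (nabla10 E G k A 1 B p * nabla10 E G l D 0 F p
           - nabla10 E G k A 0 B p * nabla10 E G l D 1 F p)
  + u p * k B p * Z A D F p.

Lemma sym4_curl1 A B D F p :
  sym4 (fun A B D F => nabla31 E G field1 A 1 B D F 0 p
                       - nabla31 E G field1 A 0 B D F 1 p) A B D F =
  sym4 (fun A B D F => curl_part1 A B D F p) A B D F.
Proof.
have sn X Y T := csmooth_nabla10 vE sG X Y T sl.
pose N A A' B B' D := nabla21 E G (nabla10 E G l) A A' B B' D p.
rewrite (sym4_box (P := fun A B D F => curl_part1 A B D F p
     - u p * k B p * Z A D F p)
  (Q := fun A B D F => u p * k B p * (N A 1 D 0 F - N A 0 D 1 F))
  (W := fun A B D F => u p * k B p * Z A D F p)).
- apply: (congr1 (fun V => sym4 V A B D F)).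
  by apply/funext => X; apply/funext => Y; apply/funext => Z1; apply/funext => T; rewrite /= subrK.
- move=> {}A {}B {}D {}F.
  rewrite /field1 !(nabla31_product vE) //.
  by rewrite /N /curl_part1; ring.
move=> {}A {}B {}D {}F.
by rewrite /N /Z -mulrDr (box sl); ring.
Qed.

Variables (a b m : 'I_2 -> M -> C).
Hypotheses (sa : forall A, csmooth (a A)) (sb : forall A, csmooth (b A))
  (sm : forall A, csmooth (m A)).

Definition contraction (F F' : 'I_2) (q : M) : C :=
  m 1 q * nabla10 E G l F F' 0 q + -1 * (m 0 q * nabla10 E G l F F' 1 q).

Definition field2 (B D F F' : 'I_2) (q : M) : C :=
  u q * (a B q * (b D q * contraction F F' q)).

Lemma csmooth_contraction F F' : csmooth (contraction F F').
Proof.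
have sn X Y T := csmooth_nabla10 vE sG X Y T sl.
apply: csmoothD; first exact: csmoothM.
by apply: csmoothM; [exact: csmooth_cst|exact: csmoothM].
Qed.

Lemma csmooth_field2 B D F F' : csmooth (field2 B D F F').
Proof.
do 3!apply: csmoothM => //; exact: csmooth_contraction.
Qed.

Definition curl_part2 (A B D F : 'I_2) (p : M) : C :=
  let L := fun F F' X => nabla10 E G l F F' X p in
  let w := fun F F' => contraction F F' p in
  a B p * b D p * (sigma E A 1 u p * w F 0 - sigma E A 0 u p * w F 1)
  + u p * (b D p * (nabla10 E G a A 1 B p * w F 0 - nabla10 E G a A 0 B p * w F 1)
   + a B p * (nabla10 E G b A 1 D p * w F 0 - nabla10 E G b A 0 D p * w F 1)
   + a B p * b D p * (nabla10 E G m A 1 1 p * L F 0 0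
       - nabla10 E G m A 1 0 p * L F 0 1
       - nabla10 E G m A 0 1 p * L F 1 0 + nabla10 E G m A 0 0 p * L F 1 1))
  + u p * a B p * b D p * (m 1 p * Z A F 0 p - m 0 p * Z A F 1 p).

Lemma sym4_curl2 A B D F p :
  sym4 (fun A B D F => nabla31 E G field2 A 1 B D F 0 p
                       - nabla31 E G field2 A 0 B D F 1 p) A B D F =
  sym4 (fun A B D F => curl_part2 A B D F p) A B D F.
Proof.
have sn X Y T := csmooth_nabla10 vE sG X Y T sl.
have sw := csmooth_contraction.
pose N A A' B B' D := nabla21 E G (nabla10 E G l) A A' B B' D p.
(* In [field2] the inner derivative carries the last index; the swap moves it to slot 3, as
   [sym4_box] requires. *)
rewrite -[LHS]sym4_swap34 -[RHS]sym4_swap34.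
rewrite (sym4_box (P := fun A B F D => curl_part2 A B D F p
     - u p * a B p * b D p * (m 1 p * Z A F 0 p - m 0 p * Z A F 1 p))
  (Q := fun A B F D => u p * a B p * b D p *
     (m 1 p * (N A 1 F 0 0 - N A 0 F 1 0) - m 0 p * (N A 1 F 0 1 - N A 0 F 1 1)))
  (W := fun A B F D => u p * a B p * b D p *
     (m 1 p * Z A F 0 p - m 0 p * Z A F 1 p))).
- apply: (congr1 (fun V => sym4 V A B D F)).
  by apply/funext => X; apply/funext => Y; apply/funext => Z1; apply/funext => T; rewrite /= subrK.
- move=> {}A {}B {}F {}D.
  have n2 X X' : nabla31 E G field2 A X B D F X' p =
     sigma E A X u p * (a B p * (b D p * contraction F X' p))
     + u p * (nabla10 E G a A X B p * (b D p * contraction F X' p)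
       + a B p * (nabla10 E G b A X D p * contraction F X' p
         + b D p * (nabla10 E G m A X 1 p * nabla10 E G l F X' 0 p
           - nabla10 E G m A X 0 p * nabla10 E G l F X' 1 p
           + m 1 p * N A X F X' 0 - m 0 p * N A X F X' 1))).
    rewrite /field2 (nabla31_product vE) //; last by move=> *; exact: csmoothM.
    by rewrite (nabla21_product vE) // (nabla11_contraction vE G_trace0).
  by rewrite !n2 /curl_part2; ring.
move=> {}A {}B {}F {}D.
have e0 := box sl A F 0 p; have e1 := box sl A F 1 p.
transitivity (u p * a B p * b D p * (m 1 p *
   (N A 1 F 0 0 - N A 0 F 1 0 + (N F 1 A 0 0 - N F 0 A 1 0))
   - m 0 p * (N A 1 F 0 1 - N A 0 F 1 1 + (N F 1 A 0 1 - N F 0 A 1 1)))).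
  by ring.
by rewrite /N e0 e1 /Z; ring.
Qed.

End SymmetrizedCurl.

(** All permutations written out without denominators, ready for [ring]. *)
Lemma sym4_24 (R : realType) (V : 'I_2 -> 'I_2 -> 'I_2 -> 'I_2 -> complex R)
    A B D F :
  24 * sym4 V A B D F =
    V A B D F + V A B F D + V A D B F + V A D F B + V A F B D + V A F D B
  + (V B A D F + V B A F D + V B D A F + V B D F A + V B F A D + V B F D A)
  + (V D A B F + V D A F B + V D B A F + V D B F A + V D F A B + V D F B A)
  + (V F A B D + V F A D B + V F B A D + V F B D A + V F D A B + V F D B A).
Proof.
have n4 : 4 != 0 :> complex R by rewrite pnatr_eq0.
have n6 : 6 != 0 :> complex R by rewrite pnatr_eq0.
have -> : (24 : complex R) = 6 * 4 by rewrite -natrM.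
rewrite /sym4 -mulrA [4 * _]mulrC divfK //.
by rewrite /sym3 -!mulrDl mulrC divfK //; ring.
Qed.

(** * Type D vacuum fields: spin coefficients and the four potentials *)

Section TypeD.
Variables (R : realType) (M : manifold4 R).
Local Notation C := (complex R).
Local Notation I := ('I_2 * 'I_2)%type.
Variables (g : M -> tvec M -> tvec M -> R) (hg : lorentzian_metric g).
Variables (E : 'I_4 -> M -> tvec M) (hE : orthonormal_tetrad g E).
Variables (G : 'I_2 -> 'I_2 -> 'I_2 -> 'I_2 -> M -> C).
Hypothesis hG : levi_civita_spinor_derivative E G.
Variable Rm : I -> I -> I -> I -> M -> C.
Hypothesis hRm : is_riemann_tensor E G Rm.
Hypothesis vacuum : forall a b p, ricci Rm a b p = 0.
Variable Psi : 'I_2 -> 'I_2 -> 'I_2 -> 'I_2 -> M -> C.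
Hypothesis hPsi : is_weyl_spinor E G Psi.

Let vE : forall j, smooth_vfield (E j). Proof. by case: hE. Qed.
Let sG : forall A A' B D, csmooth (G A A' B D). Proof. by case: hG. Qed.

Let G_trace0 A A' p : G A A' 1 1 p = - G A A' 0 0 p.
Proof.
by have := congr1 (fun f : csfun M => f p) (Gam_trace0 hE hG (A, A'));
  rewrite csfunE !GamE.
Qed.

(** Unlike the equation that determines Psi, this has no symmetrization over D. The stronger form is
    needed in [sym4_curl2], where that index is contracted with [m]. *)
Lemma spinor_box (k : 'I_2 -> M -> C) : (forall A, csmooth (k A)) ->
  forall A B D p, let N A A' B B' := nabla21 E G (nabla10 E G k) A A' B B' D p in
  (N A 1 B 0 - N A 0 B 1) + (N B 1 A 0 - N B 0 A 1) =
  2 * (Psi A B D 1 p * k 0 p - Psi A B D 0 p * k 1 p).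
Proof.
move=> sk A B D p N.
have -> : N A 1 B 0 - N A 0 B 1 + (N B 1 A 0 - N B 0 A 1) =
  (N A 1 B 0 - N B 0 A 1) + (N B 1 A 0 - N A 0 B 1) by ring.
have sym X Y Z : Psi X Y D Z p = Psi Y X D Z p.
  by case: hPsi => _ sP _; rewrite sP [RHS]sP /sym4 /sym3; ring.
rewrite /N !(nabla21_commutator hE hG sk) !sum2.
rewrite !(curv_weyl hg hE hG hRm vacuum hPsi) !raiseE !epsE.
by rewrite !(sym B A); ring.
Qed.

Variables o iota : 'I_2 -> M -> C.
Hypotheses (ho : forall A, csmooth (o A)) (hiota : forall A, csmooth (iota A)).
Hypothesis norm : forall p, o 0 p * iota 1 p = 1 + o 1 p * iota 0 p.
Variable f : M -> C.
Hypotheses (sf : csmooth f) (f0 : forall p, f p != 0).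
Hypothesis PsiE : forall A B D F p,
  Psi A B D F p = f p ^+ 3 * ooii (o^~ p) (iota^~ p) A B D F.

Lemma sigma_cube A A' p :
  sigma E A A' (fun q => f q ^+ 3) p = 3 * f p ^+ 2 * sigma E A A' f p.
Proof.
under eq_fun do rewrite exprS expr2.
by rewrite !(sigmaM vE) //; [ring|exact: csmoothM].
Qed.

Lemma nabla40_typeD A A' B D F H p : nabla40 E G Psi A A' B D F H p =
  f p ^+ 2 * (3 * sigma E A A' f p * ooii (o^~ p) (iota^~ p) B D F H
   + f p * dooii (o^~ p) (iota^~ p) (nabla10 E G o A A' ^~ p)
       (nabla10 E G iota A A' ^~ p) B D F H).
Proof.
pose t (a b c d : 'I_2 -> M -> C) B D F H q :=
  f q ^+ 3 * (a B q * (b D q * (c F q * d H q))).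
have sf3 : csmooth (fun q => f q ^+ 3).
  under eq_fun do rewrite exprS expr2.
  by apply: csmoothM => //; exact: csmoothM.
have st a b c d : (forall X, csmooth (a X)) -> (forall X, csmooth (b X)) ->
    (forall X, csmooth (c X)) -> (forall X, csmooth (d X)) ->
    forall X Y Z T, csmooth (t a b c d X Y Z T).
  by move=> *; do 4!apply: csmoothM => //.
have -> : Psi = fun B D F H q => t o o iota iota B D F H q
   + (t o iota o iota B D F H q + (t o iota iota o B D F H q
   + (t iota o o iota B D F H q + (t iota o iota o B D F H q
   + t iota iota o o B D F H q)))).
  apply/funext => X; apply/funext => Y; apply/funext => Z; apply/funext => T.
  by apply/funext => q; rewrite PsiE /t /ooii; ring.
rewrite !(nabla40D vE) //; do ?[move=> X Y Z T]; do ?[exact: st];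
  do ?[apply: csmoothD]; do ?[exact: st].
rewrite /t !(nabla40_product vE) // sigma_cube /ooii /dooii.
by ring.
Qed.

Lemma typeD_derivatives p : exists x1 x2 x3 y3 : 'I_2 -> C,
  [/\ forall A A' B, nabla10 E G o A A' B p =
        x1 A' * (o A p * o B p) + x2 A' * (o A p * iota B p)
        + x3 A' * (iota A p * o B p),
      forall A A' B, nabla10 E G iota A A' B p =
        - x1 A' * (o A p * iota B p) + y3 A' * (iota A p * o B p)
        - x3 A' * (iota A p * iota B p),
      forall A A', sigma E A A' f p =
        f p * (y3 A' * o A p + x2 A' * iota A p),
      forall A A', contraction E G o iota A A' p =
        x1 A' * o A p + x3 A' * iota A p
    & forall A A', contraction E G iota o A A' p =
        x1 A' * o A p + x3 A' * iota A p].
Proof.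
pose O A' A B := nabla10 E G o A A' B p.
pose J A' A B := nabla10 E G iota A A' B p.
have dnorm A' A : O A' A 0 * iota 1 p + o 0 p * J A' A 1 =
    O A' A 1 * iota 0 p + o 1 p * J A' A 0.
  have e : (fun q => o 0 q * iota 1 q) = (fun q => 1 + o 1 q * iota 0 q).
    by apply/funext => q; exact: norm.
  have := congr1 (fun h => sigma E A A' h p) e.
  rewrite (sigmaD vE) ?(sigma_cst vE) ?(sigmaM vE) //; first last.
  - exact: csmoothM.
  - exact: csmooth_cst.
  rewrite add0r /O /J /nabla10 /conn !sum2 !G_trace0 => s.
  apply/eqP; rewrite -subr_eq0; move/eqP: s; rewrite -subr_eq0 => /eqP s.
  by rewrite -[X in _ == X]s; apply/eqP; ring.
have bianchi A' B D F :
    3 * sigma E 1 A' f p * ooii (o^~ p) (iota^~ p) (1 - 1) B D F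
    + f p * dooii (o^~ p) (iota^~ p) (O A' 1) (J A' 1) (1 - 1) B D F =
    3 * sigma E 0 A' f p * ooii (o^~ p) (iota^~ p) (1 - 0) B D F
    + f p * dooii (o^~ p) (iota^~ p) (O A' 0) (J A' 0) (1 - 0) B D F.
  have := weyl_divergence_free hg hE hG hRm vacuum hPsi A' B D F p.
  rewrite !nabla40_typeD subrr subr0 => h.
  by apply: (mulfI _ h); rewrite expf_neq0.
have key A' := dyad_derivatives (df := fun A => sigma E A A' f p)
  (norm p) (f0 p) (dnorm A') (bianchi A').
exists (fun A' => dot2 (O A') (iota^~ p) (iota^~ p)).
exists (fun A' => - dot2 (O A') (iota^~ p) (o^~ p)).
exists (fun A' => - dot2 (O A') (o^~ p) (iota^~ p)).
exists (fun A' => - dot2 (J A') (o^~ p) (iota^~ p)).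
have n := norm p; split=> [A A' B|A A' B|A A'|A A'|A A'].
- by case: (key A') => kO _ _; exact: kO.
- by case: (key A') => _ kJ _; exact: kJ.
- by case: (key A') => _ _; exact.
- case: (key A') => kO _ _; rewrite /contraction.
  by rewrite -/(O A' A 0) -/(O A' A 1) !kO; ring: n.
case: (key A') => _ kJ _; rewrite /contraction.
by rewrite -/(J A' A 0) -/(J A' A 1) !kJ; ring: n.
Qed.

Let n24 : 24 != 0 :> C. Proof. by rewrite pnatr_eq0. Qed.

Lemma sigma_scaled_inv (c : C) A A' p :
  sigma E A A' (fun q => c * (f q)^-1) p =
  - c * (f p)^-1 ^+ 2 * sigma E A A' f p.
Proof.
have sv := csmoothV f0 sf.
rewrite (sigmaM vE) ?(sigma_cst vE) ?(sigmaV vE) //; last exact: csmooth_cst.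
by ring.
Qed.

Lemma sigma_scaled_inv2 (c : C) A A' p :
  sigma E A A' (fun q => c * ((f q)^-1 * (f q)^-1)) p =
  - 2 * c * (f p)^-1 ^+ 3 * sigma E A A' f p.
Proof.
have sv := csmoothV f0 sf.
rewrite !(sigmaM vE) ?(sigma_cst vE) ?(sigmaV vE) //; first last.
- exact: csmoothM.
- exact: csmooth_cst.
by ring.
Qed.

Lemma eq_sym4 V W A B D F : (forall A B D F, V A B D F = W A B D F) ->
  sym4 V A B D F = sym4 W A B D F :> C.
Proof. by move=> VW; rewrite /sym4 /sym3 !VW. Qed.

(** Substitutes the first derivatives at [p], clears the factor 24 and generalizes f^-1 and f. What
    is left is a polynomial identity modulo f f^-1 = 1 and the normalization, with the spin
    coefficients as free variables. *)
Ltac typeD_expand u p :=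
  let x1 := fresh in let x2 := fresh in let x3 := fresh in let y3 := fresh in
  let OE := fresh in let JE := fresh in let dfE := fresh in
  let cO := fresh in let cJ := fresh in
  have [x1 [x2 [x3 [y3 [OE JE dfE cO cJ]]]]] := typeD_derivatives p;
  under eq_sym4 => ? ? ? ? do
    [rewrite /curl_part1 /curl_part2 /u ?cO ?cJ;
     rewrite ?sigma_scaled_inv ?sigma_scaled_inv2 ?OE ?JE ?dfE ?PsiE /ooii];
  apply: (mulfI n24); rewrite mulrCA sym4_24 PsiE /ooii;
  move: (divff (f0 p)) (norm p); move: (f p)^-1 (f p).

Lemma typeD_curl_a1 A B D F p :
  let u q := -1 * (f q)^-1 in
  Psi A B D F p = 2 * f p * sym4 (fun A B D F =>
    curl_part1 E G Psi u o iota A B D F p) A B D F.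
Proof. by move=> u; typeD_expand u p => v w fv n; ring: fv n. Qed.

Lemma typeD_curl_a2 A B D F p :
  let u q := 1 * (f q)^-1 in
  Psi A B D F p = 2 * f p * sym4 (fun A B D F =>
    curl_part1 E G Psi u iota o A B D F p) A B D F.
Proof. by move=> u; typeD_expand u p => v w fv n; ring: fv n. Qed.

Lemma typeD_curl_b1 A B D F p :
  let u q := 3 * ((f q)^-1 * (f q)^-1) in
  Psi A B D F p = 2 * f p ^+ 2 *
    sym4 (fun A B D F => curl_part1 E G Psi u iota o A B D F p
            - curl_part2 E G Psi u o o iota iota A B D F p) A B D F.
Proof. by move=> u; typeD_expand u p => v w fv n; ring: fv n. Qed.

(** Here the contracted term has the same sign as the first one; the opposite weight [u'] brings the
    sum to the difference form shared with [typeD_curl_b1]. *)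
Lemma typeD_curl_b2 A B D F p :
  let u q := -3 * ((f q)^-1 * (f q)^-1) in
  let u' q := 3 * ((f q)^-1 * (f q)^-1) in
  Psi A B D F p = 2 * f p ^+ 2 *
    sym4 (fun A B D F => curl_part1 E G Psi u o iota A B D F p
            - curl_part2 E G Psi u' iota o iota o A B D F p) A B D F.
Proof. by move=> u u'; rewrite /u'; typeD_expand u p => v w fv n; ring: fv n. Qed.

(** The outer symmetrization absorbs the one inside the potential, so the potential may be replaced
    by a plain product. *)
Lemma sym4_curl_sym3 T A B D F p :
  (forall B D F F', csmooth (T B D F F')) ->
  sym4 (fun A B D F => curl E G
    (fun B D F F' q => sym3 (fun B D F => T B D F F' q) B D F) A B D F p)
    A B D F =
  sym4 (fun A B D F => nabla31 E G T A 1 B D F 0 p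
                       - nabla31 E G T A 0 B D F 1 p) A B D F.
Proof.
move=> sT; rewrite -[RHS]sym4_sym3; apply: eq_sym4 => X Y Z W.
by rewrite curlE !(nabla31_sym3 vE) // /sym3; ring.
Qed.

Lemma sym4B V W A B D F :
  sym4 (fun A B D F => V A B D F - W A B D F) A B D F =
  sym4 V A B D F - sym4 W A B D F :> C.
Proof. by rewrite /sym4 /sym3; ring. Qed.

Lemma sym4_curl_field1 u k l L A B D F p :
  csmooth u -> (forall A, csmooth (k A)) -> (forall A, csmooth (l A)) ->
  (forall B D F F' q, L B D F F' q =
    sym3 (fun B D F => field1 E G u k l B D F F' q) B D F) ->
  sym4 (fun A B D F => curl E G L A B D F p) A B D F =
  sym4 (fun A B D F => curl_part1 E G Psi u k l A B D F p) A B D F.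
Proof.
move=> su sk sl LE.
have -> : L = fun B D F F' q =>
    sym3 (fun B D F => field1 E G u k l B D F F' q) B D F.
  apply/funext => X; apply/funext => Y; apply/funext => Z; apply/funext => W.
  by apply/funext => q; exact: LE.
have s1 := csmooth_field1 vE sG su sk sl.
by rewrite sym4_curl_sym3 // (sym4_curl1 vE sG spinor_box).
Qed.

Lemma sym4_curl_fieldB u k l u' a b m l' L A B D F p :
  csmooth u -> (forall A, csmooth (k A)) -> (forall A, csmooth (l A)) ->
  csmooth u' -> (forall A, csmooth (a A)) -> (forall A, csmooth (b A)) ->
  (forall A, csmooth (m A)) -> (forall A, csmooth (l' A)) ->
  (forall B D F F' q, L B D F F' q =
    sym3 (fun B D F => field1 E G u k l B D F F' q
                       + -1 * field2 E G u' l' a b m B D F F' q) B D F) ->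
  sym4 (fun A B D F => curl E G L A B D F p) A B D F =
  sym4 (fun A B D F => curl_part1 E G Psi u k l A B D F p
          - curl_part2 E G Psi u' l' a b m A B D F p) A B D F.
Proof.
move=> su sk sl su' sa sb sm sl' LE.
have -> : L = fun B D F F' q =>
    sym3 (fun B D F => field1 E G u k l B D F F' q
                       + -1 * field2 E G u' l' a b m B D F F' q) B D F.
  apply/funext => X; apply/funext => Y; apply/funext => Z; apply/funext => W.
  by apply/funext => q; exact: LE.
have s1 := csmooth_field1 vE sG su sk sl.
have s2 := csmooth_field2 vE sG su' sl' sa sb sm.
rewrite sym4_curl_sym3; last first.
  move=> *; apply: csmoothD; first exact: s1.
  by apply: csmoothM; [exact: csmooth_cst|exact: s2].
rewrite [RHS]sym4B -(sym4_curl1 vE sG spinor_box su sk sl).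
rewrite -(sym4_curl2 vE sG G_trace0 spinor_box su' sl' sa sb sm) -sym4B.
apply: eq_sym4 => X Y Z W.
by rewrite !(nabla31B vE) //; ring.
Qed.

End TypeD.

(** * Normal form of the Weyl spinor and the theorem *)

(** Contracting [ooii] with o^A o^B iota^C iota^D leaves the single arrangement iota iota o o, whose
    value is 1; so the coefficient of [ooii] is Psi_2, nonzero because [P] is. *)
Lemma principal_spinors_ooii (R : realType)
    (P : 'I_2 -> 'I_2 -> 'I_2 -> 'I_2 -> complex R) (o iota : 'I_2 -> complex R) :
  repeated_principal_spinors P o iota -> o 0 * iota 1 = 1 + o 1 * iota 0 ->
  let P2 := \sum_A \sum_B \sum_C \sum_D P A B C D *
     raise o A * raise o B * raise iota C * raise iota D in
  P2 != 0 /\ forall A B D F, P A B D F = P2 * ooii o iota A B D F.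
Proof.
move=> [[A [B [D [F n0]]]] _ [c PE]] norm P2.
have n4 : 24 != 0 :> complex R by rewrite pnatr_eq0.
have n6 : 6 != 0 :> complex R by rewrite pnatr_eq0.
have PE' X Y Z T : P X Y Z T = c / 6 * ooii o iota X Y Z T.
  rewrite PE -mulrA; congr (_ * _); apply: (mulfI n4); rewrite sym4_24.
  have -> : 24 * (6^-1 * ooii o iota X Y Z T) = 4 * ooii o iota X Y Z T.
    have -> : (24 : complex R) = 4 * 6 by rewrite -natrM.
    by rewrite mulrA mulfK.
  by rewrite /ooii; ring.
have P2E : P2 = c / 6.
  rewrite /P2 !sum2 !raiseE !PE' /ooii; set e := c / 6.
  by ring: norm.
split; last by move=> *; rewrite P2E PE'.
by apply: contraNneq n0 => P20; rewrite PE' -P2E P20 mul0r.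
Qed.

Theorem mainTheorem2 (R : realType) (M : manifold4 R)
  (g : M -> tvec M -> tvec M -> R) (hg : lorentzian_metric g)
  (E : 'I_4 -> M -> tvec M) (hE : orthonormal_tetrad g E)
  (G : 'I_2 -> 'I_2 -> 'I_2 -> 'I_2 -> M -> complex R)
  (hG : levi_civita_spinor_derivative E G)
  (Rm : 'I_2 * 'I_2 -> 'I_2 * 'I_2 -> 'I_2 * 'I_2 -> 'I_2 * 'I_2 ->
        M -> complex R)
  (hRm : is_riemann_tensor E G Rm)
  (vacuum : forall a b p, ricci Rm a b p = 0)
  (Psi : 'I_2 -> 'I_2 -> 'I_2 -> 'I_2 -> M -> complex R)
  (hPsi : is_weyl_spinor E G Psi)
  (typeD : petrov_type_D Psi)
  (o iota : 'I_2 -> M -> complex R)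
  (ho : forall A, csmooth (o A)) (hiota : forall A, csmooth (iota A))
  (principal : forall p, repeated_principal_spinors
     (fun A B C D => Psi A B C D p) (o^~ p) (iota^~ p))
  (normalized : forall p, \sum_A o A p * raise (iota^~ p) A = 1)
  (Psi2 : M -> complex R)
  (hPsi2 : forall p, Psi2 p = \sum_A \sum_B \sum_C \sum_D Psi A B C D p *
     raise (o^~ p) A * raise (o^~ p) B *
     raise (iota^~ p) C * raise (iota^~ p) D)
  (cbrt : M -> complex R) (hcbrt : csmooth cbrt)
  (cbrtE : forall p, cbrt p ^+ 3 = Psi2 p) :
  (let f := cbrt in
   let L1 A B C A' p := - (f p)^-1 *
     sym3 (fun A B C => o A p * nabla10 E G iota B A' C p) A B C in
   let L2 A B C A' p := (f p)^-1 *
     sym3 (fun A B C => iota A p * nabla10 E G o B A' C p) A B C in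
   (forall A B C D p,
      Psi A B C D p =
      2 * f p * sym4 (fun A B C D => curl E G L1 A B C D p) A B C D) /\
   (forall A B C D p,
      Psi A B C D p =
      2 * f p * sym4 (fun A B C D => curl E G L2 A B C D p) A B C D)) /\
  (let f p := cbrt p ^+ 2 in
   let L1 A B C A' p := 3 * (f p)^-1 *
     (sym3 (fun A B C => iota A p * nabla10 E G o B A' C p) A B C -
      \sum_D raise (iota^~ p) D *
        sym3 (fun A B C => o A p * iota B p * nabla10 E G o C A' D p) A B C) in
   let L2 A B C A' p := - (3 * (f p)^-1) *
     (sym3 (fun A B C => o A p * nabla10 E G iota B A' C p) A B C +
      \sum_D raise (o^~ p) D *
        sym3 (fun A B C =>
                o A p * iota B p * nabla10 E G iota C A' D p) A B C) in
   (forall A B C D p,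
      Psi A B C D p =
      2 * f p * sym4 (fun A B C D => curl E G L1 A B C D p) A B C D) /\
   (forall A B C D p,
      Psi A B C D p =
      2 * f p * sym4 (fun A B C D => curl E G L2 A B C D p) A B C D)).
Proof.
have norm p : o 0 p * iota 1 p = 1 + o 1 p * iota 0 p.
  by have := normalized p; rewrite sum2 !raiseE => <-; ring.
have key p := principal_spinors_ooii (principal p) (norm p).
have f0 p : cbrt p != 0.
  have [n0 _] := key p; apply: contraNneq n0 => c0.
  by rewrite -hPsi2 -cbrtE c0 expr0n.
have PsiE A B C D p :
    Psi A B C D p = cbrt p ^+ 3 * ooii (o^~ p) (iota^~ p) A B C D.
  by have [_ ->] := key p; rewrite cbrtE hPsi2.
have sv := csmoothV f0 hcbrt.
have su c : csmooth (fun p => (c : complex R) * (cbrt p)^-1).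
  by apply: csmoothM => //; exact: csmooth_cst.
have su2 c : csmooth (fun p => (c : complex R) * ((cbrt p)^-1 * (cbrt p)^-1)).
  by apply: csmoothM; [exact: csmooth_cst|exact: csmoothM].
have vv p : (cbrt p ^+ 2)^-1 = (cbrt p)^-1 * (cbrt p)^-1.
  by rewrite -exprVn expr2.
have w (k : 'I_2 -> complex R) (x : 'I_2 -> complex R) :
    \sum_D raise k D * x D = k 1 * x 0 - k 0 * x 1.
  by rewrite sum2 !raiseE; ring.
split=> [f|f] L1 L2; split=> A B C D p.
- rewrite [LHS](typeD_curl_a1 hg hE hG hRm vacuum hPsi ho hiota norm hcbrt f0 PsiE).
  congr (_ * _); apply/esym.
  apply: (@sym4_curl_field1 _ _ _ hg _ hE _ hG _ hRm vacuum _ hPsi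
    _ o iota L1 A B C D p (su _)) => // *.
  by rewrite /L1 /f /field1 /sym3; ring.
- rewrite [LHS](typeD_curl_a2 hg hE hG hRm vacuum hPsi ho hiota norm hcbrt f0 PsiE).
  congr (_ * _); apply/esym.
  apply: (@sym4_curl_field1 _ _ _ hg _ hE _ hG _ hRm vacuum _ hPsi
    _ iota o L2 A B C D p (su _)) => // *.
  by rewrite /L2 /f /field1 /sym3; ring.
- rewrite [LHS](typeD_curl_b1 hg hE hG hRm vacuum hPsi ho hiota norm hcbrt f0 PsiE).
  congr (_ * _); apply/esym.
  apply: (@sym4_curl_fieldB _ _ _ hg _ hE _ hG _ hRm vacuum _ hPsi
    _ iota o _ o iota iota o L1 A B C D p (su2 _) _ _ (su2 _)) => // *.
  by rewrite /L1 /f w vv /field1 /field2 /contraction /sym3; ring.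
rewrite [LHS](typeD_curl_b2 hg hE hG hRm vacuum hPsi ho hiota norm hcbrt f0 PsiE).
congr (_ * _); apply/esym.
apply: (@sym4_curl_fieldB _ _ _ hg _ hE _ hG _ hRm vacuum _ hPsi
  _ o iota _ o iota o iota L2 A B C D p (su2 _) _ _ (su2 _)) => // *.
by rewrite /L2 /f w vv /field1 /field2 /contraction /sym3; ring.
Qed.
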